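(* Let $k$ be an algebraically closed field of characteristic zero and let $\mathcal{D}$ be an algebraic $k$-linear triangulated category of finite type with translation functor $[1]$ and a fixed enhancement. Assume that: (i) there exists a full strongly exceptional collection $\mathcal{E}=(E_1,\dots,E_\mu)$ in $\mathcal{D}$; (ii) the action of the group $G_\mu=B_\mu\ltimes\mathbb{Z}^\mu$ (by mutations and translations) on the set of isomorphism classes of full exceptional collections in $\mathcal{D}$ is transitive; (iii) for any exceptional object $E'\in\mathcal{D}$ there exists a full exceptional collection $\mathcal{E}'$ in $\mathcal{D}$ having $E'$ as one of its members. Then the quadruple consisting of - the Grothendieck group $K_0(\mathcal{D})$; - the Cartan form $I_{\mathcal{D}}:K_0(\mathcal{D})\times K_0(\mathcal{D})\to\mathbb{Z}$, $I_{\mathcal{D}}([X],[Y]):=\chi_{\mathcal{D}}([X],[Y])+\chi_{\mathcal{D}}([Y],[X])$, where $\chi_{\mathcal{D}}([X],[Y]):=\sum_{p\in\mathbb{Z}}(-1)^p\dim_k\mathrm{Hom}_{\mathcal{D}}(X,Y[p])$ is the Euler form; - the subset $\Delta_{re}(\mathcal{D}):=W(B)B\subset K_0(\mathcal{D})$, where $B:=\{[E_1],\dots,[E_\mu]\}$ and $W(B)\subset\mathrm{Aut}(K_0(\mathcal{D}),I_{\mathcal{D}})$ is the subgroup generated by the reflections $r_{[E_i]}(\lambda):=\lambda-I_{\mathcal{D}}(\lambda,[E_i])[E_i]$, $i=1,\dots,\mu$; - the automorphism $c_{\mathcal{D}}$ of $K_0(\mathcal{D})$ induced by the Coxeter functor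 $\mathcal{C}_{\mathcal{D}}:=\mathcal{S}_{\mathcal{D}}[-1]$, where $\mathcal{S}_{\mathcal{D}}$ is the Serre functor of $\mathcal{D}$, forms a simply-laced generalized root system $R_{\mathcal{D}}$, which does not depend on the choice of the full exceptional collection $\mathcal{E}$.
   Context: **Generalized root systems.** A simply-laced generalized root system $R$ consists of: a free $\mathbb{Z}$-module $K_0(R)$ of finite rank $\mu$; a symmetric bilinear form $I_R:K_0(R)\times K_0(R)\to\mathbb{Z}$; a subset $\Delta_{re}(R)\subset K_0(R)$ such that (1) $K_0(R)=\mathbb{Z}\Delta_{re}(R)$, (2) $I_R(\alpha,\alpha)=2$ for all $\alpha\in\Delta_{re}(R)$, (3) for all $\alpha\in\Delta_{re}(R)$ the element $r_\alpha\in\mathrm{Aut}(K_0(R),I_R)$, $r_\alpha(\lambda):=\lambda-I_R(\lambda,\alpha)\alpha$, satisfies $r_\alpha(\Delta_{re}(R))=\Delta_{re}(R)$, (4) there is a subset $B=\{\alpha_1,\dots,\alpha_\mu\}\subset\Delta_{re}(R)$ (a root basis) with $K_0(R)=\bigoplus_{i=1}^\mu\mathbb{Z}\alpha_i$, $W(R)=\langle r_{\alpha_1},\dots,r_{\alpha_\mu}\rangle$ and $\Delta_{re}(R)=W(R)B$, where $W(R):=\langle r_\alpha\mid\alpha\in\Delta_{re}(R)\rangle\subset\mathrm{Aut}(K_0(R),I_R)$; and an element $c_R\in W(R)$ (the Coxeter transformation) which has the presentation $c_R=r_{\alpha_1}\cdots r_{\alpha_\mu}$ with respect to a root basis $B$.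 Here $\mathrm{Aut}(K_0(R),I_R)$ is the group of automorphisms of $K_0(R)$ preserving $I_R$. **Triangulated categories.** $K_0(\mathcal{D})$ is the free abelian group on objects modulo $[X]-[Y]+[Z]$ for exact triangles $X\to Y\to Z\to X[1]$. $\mathcal{D}$ is algebraic if it is equivalent, as a triangulated category, to the stable category of a $k$-linear Frobenius category; fixing an enhancement (a dg category yielding $\mathcal{D}$) one has functorial cones and complexes $\mathbb{R}\mathrm{Hom}^\bullet_{\mathcal{D}}(X,Y)\in\mathcal{D}(k)$ (the derived category of $k$-modules) with $H^p=\mathrm{Hom}_{\mathcal{D}}(X,Y[p])$. $\mathcal{D}$ is of finite type if $\bigoplus_p\mathrm{Hom}_{\mathcal{D}}(X,Y[p])$ is finite dimensional for all $X,Y$. An object $E$ is exceptional if $\mathbb{R}\mathrm{Hom}^\bullet_{\mathcal{D}}(E,E)\cong k\cdot\mathrm{id}_E$. An exceptional collection $(E_1,\dots,E_n)$ is a finite ordered set of exceptional objects with $\mathbb{R}\mathrm{Hom}^\bullet_{\mathcal{D}}(E_i,E_j)\cong0$ for $i>j$; it is strongly exceptional if $\mathrm{Hom}_{\mathcal{D}}(E_i,E_j[p])=0$ for all $i,j$ and $p\neq0$; it is full if the smallest full triangulated subcategory of $\mathcal{D}$ containing all its members is equivalent to $\mathcal{D}$. Two collections are isomorphic if their $i$-th members are isomorphic for each $i$. **Mutations.** For an exceptional pair $(X,Y)$ (an exceptional collection of length two), the object $\mathcal{L}_XY$ is defined by: $\mathcal{L}_XY[1]$ is the cone of the evaluation $\mathbb{R}\mathrm{Hom}^\bullet_{\mathcal{D}}(X,Y)\otimes^{\mathbb{L}}X\to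 Y$; the object $\mathcal{R}_YX$ is the cone of the evaluation $X\to\mathbb{R}\mathrm{Hom}^\bullet_{\mathcal{D}}(X,Y)^*\otimes^{\mathbb{L}}Y$, with $(-)^*=\mathrm{Hom}_k(-,k)$. **The group $G_\mu$.** $B_\mu$ is Artin's braid group with generators $b_1,\dots,b_{\mu-1}$ and relations $b_ib_j=b_jb_i$ for $|i-j|\ge2$, $b_ib_{i+1}b_i=b_{i+1}b_ib_{i+1}$. $G_\mu:=B_\mu\ltimes\mathbb{Z}^\mu$, where $B_\mu$ acts on $\mathbb{Z}^\mu$ via $b_i\mapsto(i,i+1)\in\mathfrak{S}_\mu$ and permutation of coordinates. It acts on isomorphism classes of full exceptional collections by $b_i(E_1,\dots,E_\mu)=(E_1,\dots,E_{i-1},E_{i+1},\mathcal{R}_{E_{i+1}}E_i,E_{i+2},\dots,E_\mu)$, $b_i^{-1}(E_1,\dots,E_\mu)=(E_1,\dots,E_{i-1},\mathcal{L}_{E_i}E_{i+1},E_i,E_{i+2},\dots,E_\mu)$, $e_i(E_1,\dots,E_\mu)=(E_1,\dots,E_{i-1},E_i[1],E_{i+1},\dots,E_\mu)$, where $e_i$ is the $i$-th standard basis vector of $\mathbb{Z}^\mu$. *)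

(* Defs.v *)
From HB Require Import structures.
From mathcomp Require Import all_boot all_order all_algebra.
From mathcomp Require Import generic_quotient ring_quotient.
From mathcomp Require Import boolp classical_sets functions cardinality fsbigop.
From mathcomp Require Import freeg.

Set Implicit Arguments.
Unset Strict Implicit.
Unset Printing Implicit Defensive.

Import GRing.Theory.
Local Open Scope ring_scope.
Local Open Scope quotient_scope.
Local Open Scope classical_set_scope.

Section GeneralizedRootSystem.
Variable K : zmodType.
Implicit Types (I : K -> K -> int) (D B : set K) (c : K -> K).

Definition zbasis n (b : 'I_n -> K) :=
  forall x, exists! a : {ffun 'I_n -> int}, x = \sum_(i < n) b i *~ a i.

Definition bilinear_form I :=
  (forall x y z, I (x + y) z = I x z + I y z) /\
  (forall x y z, I x (y + z) = I x y + I x z).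

Definition isometric_aut I c :=
  [/\ bijective c, forall x y, c (x + y) = c x + c y
    & forall x y, I (c x) (c y) = I x y].

Definition reflection I (a x : K) : K := x - a *~ I x a.

Inductive generated_group (S : set (K -> K)) : set (K -> K) :=
| GenId : generated_group S id
| GenIn f : S f -> generated_group S f
| GenComp f g : generated_group S f -> generated_group S g ->
    generated_group S (f \o g)
| GenInv f g : generated_group S f -> cancel f g -> cancel g f ->
    generated_group S g.

Definition weyl I B : set (K -> K) :=
  generated_group [set reflection I a | a in B].

Definition weyl_orbit I B : set K := [set w b | w in weyl I B & b in B].

Definition zmod_span (S : set K) : set K :=
  [set x | forall P : set K, P 0 -> (forall y z, P y -> P z -> P (y - z)) ->
    S `<=` P -> P x].

Definition root_basis I D n (b : 'I_n -> K) :=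
  [/\ range b `<=` D, zbasis b, weyl I D = weyl I (range b)
    & D = weyl_orbit I (range b)].

(* The product r_(b 0) r_(b 1) ... : the last reflection acts first. *)
Definition coxeter_product I n (b : 'I_n -> K) : K -> K :=
  \big[(fun f g => f \o g)/id]_(i < n) reflection I (b i).

Record gen_root_system n I D c : Prop := GenRootSystem {
  grs_free : exists b : 'I_n -> K, zbasis b;
  grs_bilin : bilinear_form I;
  grs_sym : forall x y, I x y = I y x;
  grs_span : zmod_span D = setT;
  grs_norm : forall a, D a -> I a a = 2;
  grs_aut : forall a, D a -> isometric_aut I (reflection I a);
  grs_refl : forall a, D a -> [set reflection I a x | x in D] = D;
  grs_basis : exists b : 'I_n -> K, root_basis I D b;
  grs_cox_in : weyl I D c;
  grs_cox : exists b : 'I_n -> K, root_basis I D b /\ c = coxeter_product I b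
}.

End GeneralizedRootSystem.

Declare Scope cat_scope.
Delimit Scope cat_scope with C.
Local Open Scope cat_scope.

Reserved Notation "g '\oc' f" (at level 40, left associativity).

Record lcat (k : fieldType) := LCat {
  ob :> Type;
  hom : ob -> ob -> lmodType k;
  idm : forall X, hom X X;
  comp : forall X Y Z, hom Y Z -> hom X Y -> hom X Z;
  compA : forall W X Y Z (h : hom Y Z) (g : hom X Y) (f : hom W X),
    comp h (comp g f) = comp (comp h g) f;
  comp1m : forall X Y (f : hom X Y), comp (idm Y) f = f;
  compm1 : forall X Y (f : hom X Y), comp f (idm X) = f;
  comp_linl : forall X Y Z a (g g' : hom Y Z) (f : hom X Y),
    comp (a *: g + g') f = a *: comp g f + comp g' f;
  comp_linr : forall X Y Z a (g : hom Y Z) (f f' : hom X Y),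
    comp g (a *: f + f') = a *: comp g f + comp g f'
}.
Arguments idm {k l}.
Notation "g \oc f" := (comp g f) : cat_scope.

Section LinearCategory.
Variables (k : fieldType) (C : lcat k).
Implicit Types X Y Z S : C.

Definition is_iso X Y (f : hom X Y) :=
  exists g : hom Y X, g \oc f = idm X /\ f \oc g = idm Y.

Definition isom X Y := exists f : hom X Y, is_iso f.

Definition zero_obj Z :=
  (forall X (f : hom Z X), f = 0) /\ (forall X (f : hom X Z), f = 0).

Definition biproduct X Y S :=
  exists (i : hom X S) (j : hom Y S) (p : hom S X) (q : hom S Y),
    [/\ p \oc i = idm X, q \oc j = idm Y, q \oc i = 0, p \oc j = 0
      & i \oc p + j \oc q = idm S].

Definition additive_cat :=
  (exists Z, zero_obj Z) /\ (forall X Y, exists S, biproduct X Y S).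

End LinearCategory.

Record lfunctor (k : fieldType) (C D : lcat k) := LFunctor {
  fob :> C -> D;
  fmap : forall X Y, {linear hom X Y -> hom (fob X) (fob Y)};
  fmap1 : forall X, fmap X X (idm X) = idm (fob X);
  fmapM : forall X Y Z (g : hom Y Z) (f : hom X Y),
    fmap X Z (g \oc f) = fmap Y Z g \oc fmap X Y f
}.
Arguments fmap {k C D} _ {X Y}.

Definition equivalence (k : fieldType) (C D : lcat k) (F : lfunctor C D) :=
  (forall X Y, bijective (@fmap _ _ _ F X Y)) /\
  (forall Z : D, exists X : C, isom (F X) Z).

(* The translation is an autoequivalence; [unshift] chooses, on objects, an
   inverse, so that [shiftn X p] is X[p] for every integer p. *)
Record tricat (k : fieldType) := TriCat {
  tcat :> lcat k;
  tcat_additive : additive_cat tcat;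
  shift : lfunctor tcat tcat;
  shift_equiv : equivalence shift;
  unshift : tcat -> tcat;
  unshiftP : forall X, isom (shift (unshift X)) X;
  dist : forall X Y Z : tcat, hom X Y -> hom Y Z -> hom Z (shift X) -> Prop;
  dist_iso : forall (X Y Z X' Y' Z' : tcat)
      (f : hom X Y) (g : hom Y Z) (h : hom Z (shift X))
      (f' : hom X' Y') (g' : hom Y' Z') (h' : hom Z' (shift X'))
      (a : hom X X') (b : hom Y Y') (c : hom Z Z'),
    is_iso a -> is_iso b -> is_iso c ->
    b \oc f = f' \oc a -> c \oc g = g' \oc b -> fmap shift a \oc h = h' \oc c ->
    dist f g h -> dist f' g' h';
  dist_id : forall X Z, zero_obj Z ->
    dist (idm X) (0 : hom X Z) (0 : hom Z (shift X));
  dist_cone : forall X Y (f : hom X Y),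
    exists Z (g : hom Y Z) (h : hom Z (shift X)), dist f g h;
  dist_rot : forall X Y Z (f : hom X Y) (g : hom Y Z) (h : hom Z (shift X)),
    dist f g h <-> dist g h (- fmap shift f);
  dist_morph : forall (X Y Z X' Y' Z' : tcat)
      (f : hom X Y) (g : hom Y Z) (h : hom Z (shift X))
      (f' : hom X' Y') (g' : hom Y' Z') (h' : hom Z' (shift X'))
      (a : hom X X') (b : hom Y Y'),
    dist f g h -> dist f' g' h' -> b \oc f = f' \oc a ->
    exists c : hom Z Z', c \oc g = g' \oc b /\ fmap shift a \oc h = h' \oc c;
  dist_octa : forall (X Y Z U V W : tcat) (f : hom X Y) (g : hom Y Z)
      (f1 : hom Y U) (f2 : hom U (shift X))
      (g1 : hom Z V) (g2 : hom V (shift Y))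
      (h1 : hom Z W) (h2 : hom W (shift X)),
    dist f f1 f2 -> dist g g1 g2 -> dist (g \oc f) h1 h2 ->
    exists (u : hom U W) (v : hom W V),
      [/\ dist u v (fmap shift f1 \oc g2),
          u \oc f1 = h1 \oc g, h2 \oc u = f2,
          v \oc h1 = g1 & g2 \oc v = fmap shift f \oc h2]
}.
Arguments shift {k t}.
Arguments unshift {k t}.

Definition shiftn (k : fieldType) (D : tricat k) (X : D) (p : int) : D :=
  match p with
  | Posz n => iter n shift X
  | Negz n => iter n.+1 unshift X
  end.

Record subspace (k : fieldType) (V : lmodType k) := Subspace {
  sub_set : V -> Prop;
  sub0 : sub_set 0;
  subL : forall a u v, sub_set u -> sub_set v -> sub_set (a *: u + v)
}.

Section QuotientModule.
Variables (k : fieldType) (V : lmodType k) (S : subspace V).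

Definition sub_pred : {pred V} := fun v => `[< sub_set S v >].

Lemma sub_pred_zmod : zmod_closed sub_pred.
Proof.
split=> [|u v /asboolP Su /asboolP Sv]; apply/asboolP; first exact: sub0.
by rewrite -scaleN1r addrC; apply: subL.
Qed.

HB.instance Definition _ := GRing.isZmodClosed.Build V sub_pred sub_pred_zmod.

Definition quot_lmod := Quotient.quot (sub_pred : zmodClosed V).
HB.instance Definition _ := GRing.Zmodule.on quot_lmod.

Definition quot_pi (v : V) : quot_lmod :=
  \pi_(Quotient.quot (sub_pred : zmodClosed V)) v.

Definition quot_repr (x : quot_lmod) : V := repr x.

Lemma quot_piP u v : quot_pi u = quot_pi v <-> sub_set S (u - v).
Proof.
rewrite /quot_pi; split=> [/eqP|uv].
  by rewrite -Quotient.idealrBE => /asboolP.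
by apply/eqP; rewrite -Quotient.idealrBE; apply/asboolP.
Qed.

Lemma quot_piK (x : quot_lmod) : quot_pi (quot_repr x) = x.
Proof. exact: reprK. Qed.

Lemma quot_piD u v : quot_pi (u + v) = quot_pi u + quot_pi v.
Proof. exact: (raddfD (\pi_(Quotient.quot (sub_pred : zmodClosed V)))). Qed.

Lemma quot_reprP v : sub_set S (quot_repr (quot_pi v) - v).
Proof. by apply/quot_piP; rewrite quot_piK. Qed.

Definition quot_scale (a : k) (x : quot_lmod) := quot_pi (a *: quot_repr x).

Lemma quot_scaleE a v : quot_scale a (quot_pi v) = quot_pi (a *: v).
Proof.
apply/quot_piP; rewrite -scalerBr -[_ *: _]addr0.
by apply: subL; [apply: quot_reprP|apply: sub0].
Qed.

Lemma quot_scaleA a b x :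
  quot_scale a (quot_scale b x) = quot_scale (a * b) x.
Proof. by rewrite -(quot_piK x) !quot_scaleE scalerA. Qed.

Lemma quot_scale1 : left_id 1 quot_scale.
Proof. by move=> x; rewrite -(quot_piK x) quot_scaleE scale1r. Qed.

Lemma quot_scaleDr : right_distributive quot_scale +%R.
Proof.
move=> a x y; rewrite -(quot_piK x) -(quot_piK y).
by rewrite -quot_piD !quot_scaleE scalerDr quot_piD.
Qed.

Lemma quot_scaleDl x : {morph quot_scale^~ x : a b / a + b}.
Proof.
by move=> a b; rewrite -(quot_piK x) !quot_scaleE scalerDl quot_piD.
Qed.

HB.instance Definition _ := GRing.Zmodule_isLmodule.Build k quot_lmod
  quot_scaleA quot_scale1 quot_scaleDr quot_scaleDl.

Lemma quot_piL a u v : quot_pi (a *: u + v) = a *: quot_pi u + quot_pi v.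
Proof. by rewrite quot_piD -quot_scaleE. Qed.

End QuotientModule.

Section KernelCokernel.
Variables (k : fieldType) (C : lcat k).

Definition is_kernel (X Y Z : C) (i : hom X Y) (p : hom Y Z) :=
  p \oc i = 0 /\
  forall W (f : hom W Y), p \oc f = 0 -> exists! g : hom W X, i \oc g = f.

Definition is_cokernel (X Y Z : C) (i : hom X Y) (p : hom Y Z) :=
  p \oc i = 0 /\
  forall W (f : hom Y W), f \oc i = 0 -> exists! g : hom Z W, g \oc p = f.

Definition is_pushout (X Y X' Y' : C) (i : hom X Y) (f : hom X X')
    (f' : hom Y Y') (i' : hom X' Y') :=
  f' \oc i = i' \oc f /\
  forall W (u : hom Y W) (v : hom X' W), u \oc i = v \oc f ->
    exists! g : hom Y' W, g \oc f' = u /\ g \oc i' = v.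

Definition is_pullback (Y Z Y' Z' : C) (p : hom Y Z) (f : hom Z' Z)
    (f' : hom Y' Y) (p' : hom Y' Z') :=
  p \oc f' = f \oc p' /\
  forall W (u : hom W Y) (v : hom W Z'), p \oc u = f \oc v ->
    exists! g : hom W Y', f' \oc g = u /\ p' \oc g = v.

Variable conf : forall X Y Z : C, hom X Y -> hom Y Z -> Prop.

Definition inflation (X Y : C) (i : hom X Y) :=
  exists Z (p : hom Y Z), conf i p.

Definition deflation (Y Z : C) (p : hom Y Z) :=
  exists X (i : hom X Y), conf i p.

End KernelCokernel.

Record exact_cat (k : fieldType) := ExactCat {
  ecat :> lcat k;
  ecat_additive : additive_cat ecat;
  conf : forall X Y Z : ecat, hom X Y -> hom Y Z -> Prop;
  conf_ker : forall X Y Z (i : hom X Y) (p : hom Y Z),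
    conf i p -> is_kernel i p;
  conf_coker : forall X Y Z (i : hom X Y) (p : hom Y Z),
    conf i p -> is_cokernel i p;
  conf_iso : forall (X Y Z X' Y' Z' : ecat) (i : hom X Y) (p : hom Y Z)
      (i' : hom X' Y') (p' : hom Y' Z')
      (a : hom X X') (b : hom Y Y') (c : hom Z Z'),
    is_iso a -> is_iso b -> is_iso c ->
    b \oc i = i' \oc a -> c \oc p = p' \oc b -> conf i p -> conf i' p';
  infl_id : forall X, inflation conf (idm X);
  defl_id : forall X, deflation conf (idm X);
  infl_comp : forall X Y Z (i : hom X Y) (j : hom Y Z),
    inflation conf i -> inflation conf j -> inflation conf (j \oc i);
  defl_comp : forall X Y Z (p : hom X Y) (q : hom Y Z),
    deflation conf p -> deflation conf q -> deflation conf (q \oc p);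
  infl_pushout : forall (X Y X' : ecat) (i : hom X Y) (f : hom X X'),
    inflation conf i -> exists Y' (f' : hom Y Y') (i' : hom X' Y'),
      is_pushout i f f' i' /\ inflation conf i';
  defl_pullback : forall (Y Z Z' : ecat) (p : hom Y Z) (f : hom Z' Z),
    deflation conf p -> exists Y' (f' : hom Y' Y) (p' : hom Y' Z'),
      is_pullback p f f' p' /\ deflation conf p'
}.
Arguments conf {k e X Y Z}.

Section ProjectiveInjective.
Variables (k : fieldType) (F : exact_cat k).

Definition projective (P : F) :=
  forall (Y Z : F) (p : hom Y Z) (f : hom P Z), deflation (@conf _ F) p ->
    exists g : hom P Y, p \oc g = f.

Definition injective_obj (I : F) :=
  forall (X Y : F) (i : hom X Y) (f : hom X I), inflation (@conf _ F) i ->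
    exists g : hom Y I, g \oc i = f.

End ProjectiveInjective.

Record frobenius_cat (k : fieldType) := FrobeniusCat {
  fcat :> exact_cat k;
  enough_proj : forall X : fcat, exists (K P : fcat) (i : hom K P)
    (p : hom P X), conf i p /\ projective P;
  enough_inj : forall X : fcat, exists (I Z : fcat) (i : hom X I)
    (p : hom I Z), conf i p /\ injective_obj I;
  proj_inj : forall P : fcat, projective P <-> injective_obj P
}.

Section StableCategory.
Variables (k : fieldType) (F : frobenius_cat k).
Implicit Types X Y Z : F.

Definition stably_null X Y : set (hom X Y) :=
  [set f | exists (P : F) (b : hom P Y) (a : hom X P),
    projective P /\ f = b \oc a].

Lemma comp0m X Y Z (f : hom X Y) : (0 : hom Y Z) \oc f = 0.
Proof.
by have := comp_linl (-1) (0 : hom Y Z) 0 f; rewrite scaleN1r addNr scaleN1r addNr.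
Qed.

Lemma compm0 X Y Z (g : hom Y Z) : g \oc (0 : hom X Y) = 0.
Proof.
by have := comp_linr (-1) g (0 : hom X Y) 0; rewrite scaleN1r addNr scaleN1r addNr.
Qed.

Lemma compDm X Y Z (g g' : hom Y Z) (f : hom X Y) :
  (g + g') \oc f = g \oc f + g' \oc f.
Proof. by have := comp_linl 1 g g' f; rewrite !scale1r. Qed.

Lemma compmD X Y Z (g : hom Y Z) (f f' : hom X Y) :
  g \oc (f + f') = g \oc f + g \oc f'.
Proof. by have := comp_linr 1 g f f'; rewrite !scale1r. Qed.

Lemma compZm X Y Z a (g : hom Y Z) (f : hom X Y) :
  (a *: g) \oc f = a *: (g \oc f).
Proof. by have := comp_linl a g 0 f; rewrite !addr0 comp0m addr0. Qed.

Lemma compmZ X Y Z a (g : hom Y Z) (f : hom X Y) :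
  g \oc (a *: f) = a *: (g \oc f).
Proof. by have := comp_linr a g f 0; rewrite !addr0 compm0 addr0. Qed.

Lemma compBm X Y Z (g g' : hom Y Z) (f : hom X Y) :
  (g - g') \oc f = g \oc f - g' \oc f.
Proof. by rewrite compDm -scaleN1r compZm scaleN1r. Qed.

Lemma compmB X Y Z (g : hom Y Z) (f f' : hom X Y) :
  g \oc (f - f') = g \oc f - g \oc f'.
Proof. by rewrite compmD -scaleN1r compmZ scaleN1r. Qed.

Lemma stably_null0 X Y : stably_null (0 : hom X Y).
Proof.
have [K [P [_ [_ [_ projP]]]]] := enough_proj X.
by exists P, 0, 0; rewrite comp0m.
Qed.

Lemma stably_nullL X Y a (f g : hom X Y) :
  stably_null f -> stably_null g -> stably_null (a *: f + g).
Proof.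
move=> [P [b [c [projP ->]]]] [P' [b' [c' [projP' ->]]]].
have [S [i [j [p [q [pi1 qj1 qi0 pj0 ipjq]]]]]] := (ecat_additive F).2 P P'.
exists S, (a *: (b \oc p) + b' \oc q), (i \oc c + j \oc c'); split; last first.
  rewrite compDm compZm !compmD !compA -!(compA _ p) -!(compA _ q).
  by rewrite pi1 qj1 qi0 pj0 !compm1 !compm0 !comp0m addr0 add0r.
move=> Y' Z' r f' defr; have [u ru] := projP _ _ r (f' \oc i) defr.
have [v rv] := projP' _ _ r (f' \oc j) defr.
exists (u \oc p + v \oc q).
by rewrite compmD !compA ru rv -!compA -compmD ipjq compm1.
Qed.

Definition null_subspace X Y : subspace (hom X Y) :=
  Subspace (@stably_null0 X Y) (@stably_nullL X Y).

Definition stable_hom X Y : lmodType k := quot_lmod (null_subspace X Y).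

Definition stable_pi X Y (f : hom X Y) : stable_hom X Y :=
  quot_pi (null_subspace X Y) f.

Definition stable_comp X Y Z (g : stable_hom Y Z) (f : stable_hom X Y) :
  stable_hom X Z := stable_pi (quot_repr g \oc quot_repr f).

Lemma stable_compE X Y Z (g : hom Y Z) (f : hom X Y) :
  stable_comp (stable_pi g) (stable_pi f) = stable_pi (g \oc f).
Proof.
apply/quot_piP.
have [P [b [a [projP fE]]]] := quot_reprP (null_subspace X Y) f.
have [P' [b' [a' [projP' gE]]]] := quot_reprP (null_subspace Y Z) g.
set f1 := quot_repr _ in fE *; set g1 := quot_repr _ in gE *.
have -> : g1 \oc f1 - g \oc f = 1 *: ((g1 - g) \oc f1) + g \oc (f1 - f).
  by rewrite scale1r compBm compmB addrA subrK.
apply: stably_nullL; [exists P', b', (a' \oc f1)|exists P, (g \oc b), a].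
  by rewrite gE compA.
by rewrite fE compA.
Qed.

Lemma stable_piK X Y (f : stable_hom X Y) : stable_pi (quot_repr f) = f.
Proof. exact: quot_piK. Qed.

Lemma stable_piL X Y a (f g : hom X Y) :
  stable_pi (a *: f + g) = a *: stable_pi f + stable_pi g.
Proof. exact: quot_piL. Qed.

Definition stable_cat : lcat k.
Proof.
refine (@LCat k F stable_hom (fun X => stable_pi (idm X)) stable_comp
  _ _ _ _ _).
- move=> W X Y Z h g f.
  by rewrite -(stable_piK h) -(stable_piK g) -(stable_piK f)
    !stable_compE compA.
- by move=> X Y f; rewrite -(stable_piK f) stable_compE comp1m.
- by move=> X Y f; rewrite -(stable_piK f) stable_compE compm1.
- move=> X Y Z a g g' f.
  rewrite -(stable_piK g) -(stable_piK g') -(stable_piK f).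
  by rewrite -stable_piL !stable_compE comp_linl stable_piL.
- move=> X Y Z a g f f'.
  rewrite -(stable_piK g) -(stable_piK f) -(stable_piK f').
  by rewrite -stable_piL !stable_compE comp_linr stable_piL.
Defined.

End StableCategory.

(* The suspension of the stable category is susp, for chosen conflations
   X -> I X -> susp X with I X injective, and its triangles are, up to
   isomorphism, the X -> Y -> Z -> susp X where the first two maps form a
   conflation and the third one is induced by an extension Y -> I X of
   X -> I X.  The data below are a k-linear equivalence Phi from the stable
   category to D and a natural isomorphism sigma : Phi susp -> [1] Phi that
   carries these triangles to distinguished ones. *)
Definition algebraic (k : fieldType) (D : tricat k) : Prop :=
  exists (F : frobenius_cat k) (I susp : F -> F)
    (inj : forall X : F, hom X (I X)) (prj : forall X : F, hom (I X) (susp X))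
    (Phi : lfunctor (stable_cat F) D)
    (sigma : forall X : F, hom (Phi (susp X)) (shift (Phi X))),
    [/\ forall X : F, conf (inj X) (prj X) /\ injective_obj (I X),
        equivalence Phi,
        forall X : F, is_iso (sigma X),
        forall (X Y : F) (f : hom X Y) (g : hom (I X) (I Y))
            (h : hom (susp X) (susp Y)),
          g \oc inj X = inj Y \oc f -> prj Y \oc g = h \oc prj X ->
          sigma Y \oc fmap Phi (stable_pi h)
            = fmap shift (fmap Phi (stable_pi f)) \oc sigma X
      & forall (X Y Z : F) (u : hom X Y) (v : hom Y Z)
            (g : hom Y (I X)) (w : hom Z (susp X)),
          conf u v -> g \oc u = inj X -> w \oc v = prj X \oc g ->
          dist (fmap Phi (stable_pi u)) (fmap Phi (stable_pi v))
            (sigma X \oc fmap Phi (stable_pi w))].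

Definition has_dim (k : fieldType) (V : lmodType k) (n : nat) :=
  exists f : {linear 'rV[k]_n -> V}, bijective f.

(* The junk value for an infinite dimensional V is 0. *)
Definition dimk (k : fieldType) (V : lmodType k) : nat :=
  xget 0%N [set n | has_dim V n].

Section Exceptional.
Variables (k : fieldType) (D : tricat k).
Implicit Types (X Y Z T : D) (p : int).

Local Notation "X [[ p ]]" := (shiftn X p) (at level 2, format "X [[ p ]]").

Definition finite_type :=
  forall X Y, (forall p, exists n, has_dim (hom X Y[[p]]) n) /\
    finite_set [set p | exists f : hom X Y[[p]], f != 0].

Definition exceptional X :=
  [/\ forall p, p != 0 -> forall f : hom X X[[p]], f = 0,
      idm X != 0 & forall f : hom X X, exists a : k, f = a *: idm X].

Definition exc_collection n (E : 'I_n -> D) :=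
  (forall i, exceptional (E i)) /\
  (forall i j : 'I_n, (j < i)%N ->
     forall p (f : hom (E i) (E j)[[p]]), f = 0).

Definition strongly_exc n (E : 'I_n -> D) :=
  exc_collection E /\
  forall i j p, p != 0 -> forall f : hom (E i) (E j)[[p]], f = 0.

Record triangulated_subcat (P : set D) : Prop := TriangulatedSubcat {
  sub_isom : forall X Y, isom X Y -> P X -> P Y;
  sub_zero : forall Z, zero_obj Z -> P Z;
  sub_shift : forall X, P X -> P (shift X);
  sub_unshift : forall X, P X -> P (unshift X);
  sub_cone : forall X Y Z (f : hom X Y) (g : hom Y Z) (h : hom Z (shift X)),
    dist f g h -> P X -> P Y -> P Z
}.

(* The inclusion of a strictly full subcategory is an equivalence exactly when
   that subcategory contains every object. *)
Definition full_collection n (E : 'I_n -> D) :=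
  \bigcap_(P in [set P | triangulated_subcat P /\ range E `<=` P]) P = setT.

Definition full_exc n (E : 'I_n -> D) := exc_collection E /\ full_collection E.

(* Over a field a complex is isomorphic to its cohomology, so that
   RHom(X,Y) (x) X is the sum over p of Hom(X[p],Y) (x) X[p], where
   Hom(X[p],Y) = H^(-p) RHom(X,Y).  It is characterized by its maps out:
   families of linear maps Hom(X[p],Y) -> Hom(X[p],Z).  The evaluation is the
   map that corresponds to the family of identities. *)
Definition rhom_tensor X Y T
    (u : forall p, {linear hom X[[p]] Y -> hom X[[p]] T}) :=
  forall Z (phi : forall p, {linear hom X[[p]] Y -> hom X[[p]] Z}),
    exists! g : hom T Z, forall p v, g \oc u p v = phi p v.

Definition left_mutation X Y L :=
  exists T (u : forall p, {linear hom X[[p]] Y -> hom X[[p]] T})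
      (ev : hom T Y) (g : hom Y (shift L)) (h : hom (shift L) (shift T)),
    [/\ rhom_tensor u, forall p v, ev \oc u p v = v & dist ev g h].

(* Dually, RHom(X,Y)^* (x) Y is the sum over p of Hom(X,Y[p])^* (x) Y[p], that
   is of Hom_k(Hom(X,Y[p]), Y[p]), characterized by its maps in: families of
   linear maps Hom(X,Y[p]) -> Hom(Z,Y[p]). *)
Definition rhom_cotensor X Y T
    (w : forall p, {linear hom X Y[[p]] -> hom T Y[[p]]}) :=
  forall Z (phi : forall p, {linear hom X Y[[p]] -> hom Z Y[[p]]}),
    exists! g : hom Z T, forall p v, w p v \oc g = phi p v.

Definition right_mutation X Y R :=
  exists T (w : forall p, {linear hom X Y[[p]] -> hom T Y[[p]]})
      (coev : hom X T) (g : hom T R) (h : hom R (shift X)),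
    [/\ rhom_cotensor w, forall p v, w p v \oc coev = v & dist coev g h].

End Exceptional.

(* The group G_mu, presented by generators and relations: [inl i] is b_(i+1),
   exchanging positions i and i+1 counted from 0; [inr i] is e_(i+1); a letter
   (true, x) stands for the inverse of the generator x. *)

Section BraidGroup.
Variable mu : nat.

Definition gmu_gen : Type := ('I_mu.-1 + 'I_mu)%type.
Definition gmu_letter : Type := (bool * gmu_gen)%type.
Definition gmu_word : Type := seq gmu_letter.

Local Notation b i := ((false, inl i) : gmu_letter).
Local Notation e i := ((false, inr i) : gmu_letter).

Definition swap_pos (i : 'I_mu.-1) (j j' : 'I_mu) :=
  [\/ j = i :> nat /\ j' = i.+1 :> nat, j = i.+1 :> nat /\ j' = i :> nat
    | [/\ j <> i :> nat, j <> i.+1 :> nat & j' = j]].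

Inductive gmu_rel : gmu_word -> gmu_word -> Prop :=
| GmuRefl w : gmu_rel w w
| GmuSym w w' : gmu_rel w w' -> gmu_rel w' w
| GmuTrans w w' w'' : gmu_rel w w' -> gmu_rel w' w'' -> gmu_rel w w''
| GmuCat v v' w w' : gmu_rel v v' -> gmu_rel w w' -> gmu_rel (v ++ w) (v' ++ w')
| GmuInv s x : gmu_rel [:: (s, x); (~~ s, x)] [::]
| GmuComm (i j : 'I_mu.-1) : (i.+1 < j)%N -> gmu_rel [:: b i; b j] [:: b j; b i]
| GmuBraid (i j : 'I_mu.-1) : j = i.+1 :> nat ->
    gmu_rel [:: b i; b j; b i] [:: b j; b i; b j]
| GmuTransl (i j : 'I_mu) : gmu_rel [:: e i; e j] [:: e j; e i]
| GmuSemidirect (i : 'I_mu.-1) (j j' : 'I_mu) : swap_pos i j j' ->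
    gmu_rel [:: b i; e j] [:: e j'; b i].

Definition gmu_relb : rel gmu_word := fun w w' => `[< gmu_rel w w' >].

Lemma gmu_relb_equiv : equiv_class_of gmu_relb.
Proof.
split=> [w|w w'|w' w w''].
- exact/asboolP/GmuRefl.
- by apply/asboolP/asboolP => ?; apply: GmuSym.
- by move=> /asboolP ? /asboolP ?; apply/asboolP; apply: (@GmuTrans _ w').
Qed.

Canonical gmu_equiv := EquivRelPack gmu_relb_equiv.
Canonical gmu_encModRel := defaultEncModRel gmu_relb.

Definition braid_semidirect := {eq_quot gmu_relb}.
Definition gmu_class (w : gmu_word) : braid_semidirect :=
  \pi_{eq_quot gmu_relb} w.

End BraidGroup.

Section MutationAction.
Variables (k : fieldType) (D : tricat k) (mu : nat).
Implicit Types E : 'I_mu -> D.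

Definition isom_coll E E' := forall i, isom (E i) (E' i).

(* [letter_acts x E E'] : E' is in the isomorphism class x E. *)
Definition letter_acts (x : gmu_letter mu) E E' : Prop :=
  match x with
  | (false, inl i) => forall j : 'I_mu,
      [/\ j = i :> nat ->
            forall j1 : 'I_mu, j1 = i.+1 :> nat -> isom (E j1) (E' j),
          j = i.+1 :> nat ->
            forall j0 : 'I_mu, j0 = i :> nat -> right_mutation (E j0) (E j) (E' j)
        & j <> i :> nat -> j <> i.+1 :> nat -> isom (E j) (E' j)]
  | (true, inl i) => forall j : 'I_mu,
      [/\ j = i :> nat ->
            forall j1 : 'I_mu, j1 = i.+1 :> nat -> left_mutation (E j) (E j1) (E' j),
          j = i.+1 :> nat ->
            forall j0 : 'I_mu, j0 = i :> nat -> isom (E j0) (E' j)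
        & j <> i :> nat -> j <> i.+1 :> nat -> isom (E j) (E' j)]
  | (false, inr i) => forall j,
      isom (if j == i then shift (E j) else E j) (E' j)
  | (true, inr i) => forall j,
      isom (if j == i then unshift (E j) else E j) (E' j)
  end.

Fixpoint word_acts (w : gmu_word mu) E E' : Prop :=
  if w is x :: w' then exists2 E1, word_acts w' E E1 & letter_acts x E1 E'
  else isom_coll E E'.

Definition gmu_acts (g : braid_semidirect mu) E E' :=
  exists2 w, gmu_class w = g & word_acts w E E'.

Definition gmu_transitive :=
  forall E E', full_exc E -> full_exc E' -> exists g, gmu_acts g E E'.

End MutationAction.

Section Grothendieck.
Variables (k : fieldType) (D : tricat k).

Definition free_K0 := {freeg {classic D} / int}.

Definition obj_gen (X : D) : free_K0 := << (X : {classic D}) >>.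

Definition K0_relators : set free_K0 :=
  [set x | exists (X Y Z : D) (f : hom X Y) (g : hom Y Z)
      (h : hom Z (shift X)),
    dist f g h /\ x = obj_gen X - obj_gen Y + obj_gen Z].

Definition K0_null : {pred free_K0} := fun x => `[< zmod_span K0_relators x >].

Lemma K0_null_zmod : zmod_closed K0_null.
Proof.
split=> [|x y /asboolP xN /asboolP yN]; apply/asboolP => P P0 PB PS //.
exact: (PB _ _ (xN P P0 PB PS) (yN P P0 PB PS)).
Qed.

HB.instance Definition _ := GRing.isZmodClosed.Build free_K0 K0_null
  K0_null_zmod.

Definition K0 : zmodType := Quotient.quot (K0_null : zmodClosed free_K0).

Definition K0_class (X : D) : K0 :=
  \pi_(Quotient.quot (K0_null : zmodClosed free_K0)) (obj_gen X).

Definition euler (X Y : D) : int :=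
  \sum_(p \in [set: int]) (-1) ^ p * (dimk (hom X (shiftn Y p)))%:Z.

Definition euler_form (chi : K0 -> K0 -> int) :=
  bilinear_form chi /\
  forall X Y : D, chi (K0_class X) (K0_class Y) = euler X Y.

Definition cartan_form (chi : K0 -> K0 -> int) : K0 -> K0 -> int :=
  fun x y => chi x y + chi y x.

Definition real_roots (I : K0 -> K0 -> int) n (E : 'I_n -> D) : set K0 :=
  weyl_orbit I (range (fun i => K0_class (E i))).

(* The Serre functor is not required to be exact: that is automatic.
   [phi X Y f] is the linear form on Hom(Y,SX) corresponding to f in Hom(X,Y)
   under the isomorphism of Hom(X,Y) with the dual of Hom(Y,SX). *)
Definition serre_functor (S : lfunctor D D) :=
  equivalence S /\
  exists phi : forall X Y : D, hom X Y -> {linear hom Y (S X) -> k^o},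
    [/\ forall X Y a (f f' : hom X Y) g,
          phi X Y (a *: f + f') g = a * phi X Y f g + phi X Y f' g,
        forall X Y, bijective (phi X Y)
      & forall (X X' Y Y' : D) (a : hom X' X) (b : hom Y Y') (f : hom X Y)
          (g : hom Y' (S X')),
          phi X' Y' (b \oc f \oc a) g = phi X Y f (fmap S a \oc g \oc b)].

Definition coxeter_functor (S : lfunctor D D) (X : D) : D := unshift (S X).

Definition induced_on_K0 (C : D -> D) (c : K0 -> K0) :=
  [/\ bijective c, forall x y, c (x + y) = c x + c y
    & forall X, c (K0_class X) = K0_class (C X)].

End Grothendieck.

(* Main.v *)
Require Import Defs.
From Stdlib Require List.
From HB Require Import structures.
From mathcomp Require Import generic_quotient ring_quotient freeg.
From mathcomp Require Import all_boot all_order all_algebra.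
From mathcomp Require Import ring zify.
From mathcomp Require Import boolp classical_sets functions cardinality fsbigop.

Set Implicit Arguments.
Unset Strict Implicit.
Unset Printing Implicit Defensive.

Import GRing.Theory Defs.
Local Open Scope ring_scope.

(* A Serre functor amounts to choosing, for each X, an object Z and a linear form
   tau on Hom(X,Z) such that the pairings (f, g) |-> tau (g f) between Hom(X,Y)
   and Hom(Y,Z) are perfect for all Y.  By the five lemma the shifts of the
   members of a full exceptional collection suffice as Y, and for these Z is
   built step by step, from the last member to the first.  The same argument in
   the opposite category gives essential surjectivity of the Serre functor.

   The Gram matrix of the Euler form chi on the classes of an exceptional
   collection is unitriangular, so these classes form a basis and chi is
   nondegenerate.  Hence Serre duality chi(x,y) = chi(y,Sx) determines the action
   of S on K_0, without exactness of S, and c = -S is the product of the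
   reflections because both satisfy chi(y,cx) = -chi(x,y).

   On classes a mutation is, up to sign and position, a reflection in a member of
   the collection, so it preserves the set W(B)B; transitivity of the group action
   then gives independence of the collection. *)

(** * Linear algebra *)

(** The dual objects are built in a bare linear category, with cones reduced to one abstract
    condition on maps. This is what allows the opposite category to be used without giving it
    triangles of its own. Within one step, forms are added before the radical is killed, because
    coning off radical maps preserves the values of the form and so keeps what was already
    separated. Exact sequences for the Euler form need a translation acting on maps, while [unshift]
    acts on objects only. All Hom spaces are therefore moved to nonnegative iterates of the
    translation, in a window wide enough for the end terms to vanish. Along a word of G_mu the
    intermediate collections are followed through their classes, and the invariant carried is the
    unitriangularity [num_exc]. A mutation is given by a universal property; its class is computed
    by comparing the universal object with an explicit finite biproduct. *)

Lemma In_cat T (x : T) s t :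
  List.In x (s ++ t) <-> List.In x s \/ List.In x t.
Proof.
by elim: s => [|y s IHs] /=; [split=> [|[]//]; right|rewrite IHs or_assoc].
Qed.

Lemma In_map T U (f : T -> U) y s :
  List.In y (map f s) <-> exists x, f x = y /\ List.In x s.
Proof. exact: List.in_map_iff. Qed.

Lemma In_mem (T : eqType) (x : T) s : List.In x s <-> x \in s.
Proof.
elim: s => //= y s IHs; rewrite inE IHs; split.
  by case=> [->|->]; rewrite ?eqxx ?orbT.
by case/predU1P=> [->|]; [left|right].
Qed.

Section LinearAlgebra.
Variable k : fieldType.
Implicit Types U V W : lmodType k.

Definition lin U V (f : U -> V) (fL : linear f) : {linear U -> V} :=
  HB.pack f (GRing.isLinear.Build k U V *:%R f fL).

Lemma lin_inj U V (f g : {linear U -> V}) : f =1 g -> f = g.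
Proof.
case: f g => f [[f1] [f2]] [g [[g1] [g2]]] /= /funext efg.
by subst g; rewrite (Prop_irrelevance f1 g1) (Prop_irrelevance f2 g2).
Qed.

Lemma lformZ U (f : {linear U -> k^o}) a u : f (a *: u) = a * f u.
Proof. exact: linearZ_LR. Qed.

Lemma lformP U (f : {linear U -> k^o}) a u v :
  f (a *: u + v) = a * f u + f v.
Proof. exact: linearP. Qed.

Lemma lin_inv U V (f : {linear U -> V}) : bijective f ->
  exists g : {linear V -> U}, cancel f g /\ cancel g f.
Proof.
case=> g fg gf; have gL : linear g.
  by move=> a u v; apply: (can_inj fg); rewrite linearP !gf.
by exists (lin gL).
Qed.

Definition fd V := exists n, has_dim V n.

Lemma has_dim_iso V n : has_dim V n ->
  exists (a : {linear 'rV[k]_n -> V}) (b : {linear V -> 'rV[k]_n}),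
    cancel a b /\ cancel b a.
Proof. by case=> a /lin_inv [b ab]; exists a, b. Qed.

Lemma linear_mx m n (f : {linear 'rV[k]_m -> 'rV[k]_n}) :
  exists M : 'M_(m, n), forall x, f x = x *m M.
Proof. by exists (lin1_mx f) => x; rewrite mul_rV_lin1. Qed.

Lemma form_mx m (f : {linear 'rV[k]_m -> k^o}) :
  exists M : 'cV_m, forall x, f x = (x *m M) 0 0.
Proof.
pose g x : 'rV[k]_1 := (f x)%:M.
have gL : linear g.
  move=> a u v; rewrite /g linearP; apply/rowP => i; rewrite !mxE !ord1 !eqxx.
  by rewrite !mulr1n.
have [M Mg] := linear_mx (lin gL).
by exists M => x; rewrite -Mg /= /g mxE eqxx mulr1n.
Qed.

Lemma mx_form_linear V n (b : {linear V -> 'rV[k]_n}) (M : 'cV_n) :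
  linear (fun v => (b v *m M) 0 0 : k^o).
Proof. by move=> a u v; rewrite linearP mulmxDl -scalemxAl !mxE. Qed.

Lemma has_dim_inj U V m n (f : {linear U -> V}) :
  has_dim U m -> has_dim V n -> injective f -> (m <= n)%N.
Proof.
move=> /has_dim_iso [a [a' [aK a'K]]] /has_dim_iso [b [b' [bK b'K]]] fI.
have [M ME] := linear_mx (b' \o f \o a).
have M_free : row_free M.
  rewrite -kermx_eq0; apply/eqP/row_matrixP => i; rewrite row0.
  apply: (can_inj aK); apply: fI; apply: (can_inj b'K).
  by rewrite -[b' _]/((b' \o f \o a) _) ME -row_mul mulmx_ker row0 !linear0.
by rewrite -(eqP M_free) rank_leq_col.
Qed.

Lemma has_dim_uniq V m n : has_dim V m -> has_dim V n -> m = n.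
Proof.
move=> Vm Vn; apply/eqP; rewrite eqn_leq.
by rewrite !(@has_dim_inj V V _ _ idfun).
Qed.

Lemma has_dim_bij U V n (f : {linear U -> V}) :
  bijective f -> has_dim U n -> has_dim V n.
Proof.
move=> fB [a aB]; exists (f \o a : {linear _ -> _}).
exact: bij_comp.
Qed.

Lemma dimkE V n : has_dim V n -> dimk V = n.
Proof.
move=> Vn; rewrite /dimk; case: xgetP => [m _ Vm|/(_ n)/(_ Vn)//].
exact: has_dim_uniq Vm Vn.
Qed.

Lemma dimkP V : fd V -> has_dim V (dimk V).
Proof. by case=> n Vn; rewrite (dimkE Vn). Qed.

Lemma dimk_bij U V (f : {linear U -> V}) : bijective f -> dimk U = dimk V.
Proof.
move=> fB; have [g [fK gK]] := lin_inv fB.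
have gB : bijective g by exists f.
case: (pselect (fd U)) => [[n Un]|Ufd].
  by rewrite (dimkE Un) (dimkE (has_dim_bij fB Un)).
have Vfd : ~ fd V by case=> n /(has_dim_bij gB) Un; apply: Ufd; exists n.
rewrite /dimk !xgetPN // => n ?; first by apply: Vfd; exists n.
by apply: Ufd; exists n.
Qed.

Lemma dimk0 V : (forall v : V, v = 0) -> dimk V = 0%N.
Proof.
move=> V0; apply: dimkE; exists (\0 : {linear 'rV[k]_0 -> V}).
by exists (fun=> 0) => x; [rewrite [RHS]thinmx0|rewrite [LHS]V0 [RHS]V0].
Qed.

Lemma coords V : fd V ->
  exists n (e : 'I_n -> V) (c : 'I_n -> {linear V -> k^o}),
  [/\ has_dim V n, forall v, v = \sum_i c i v *: e i
    & forall i j, c i (e j) = (i == j)%:R].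
Proof.
case=> n Vn; have [a [b [aK bK]]] := has_dim_iso Vn.
exists n, (fun i => a (delta_mx 0 i)).
exists (fun i => lin (@mx_form_linear V n b (delta_mx i 0))).
have cE (v : 'rV[k]_n) (i : 'I_n) : (v *m delta_mx i 0) 0 0 = v 0 i.
  rewrite mxE (bigD1 i) //= mxE !eqxx mulr1 big1 ?addr0 // => j ji.
  by rewrite mxE (negPf ji) mulr0.
split=> // [v|i j].
  rewrite -{1}[v]bK {1}[b v]row_sum_delta linear_sum; apply: eq_bigr => i _.
  by rewrite linearZ /= cE.
by rewrite /= cE aK mxE eqxx eq_sym.
Qed.

Lemma sep_form V (v : V) : fd V -> (forall f : {linear V -> k^o}, f v = 0) ->
  v = 0.
Proof.
move=> /coords [n [e [c [_ vE _]]]] v0.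
by rewrite [v]vE big1 // => i _; rewrite v0 scale0r.
Qed.

(** With M the matrix of [f] and M^+ its pseudo-inverse, x and x M M^+ have the same image, so [phi]
    takes the same value on both. Hence [phi] read through M^+ is a form on all of V, even if [f] is
    not surjective. *)
Lemma factor_form U V (f : {linear U -> V}) (phi : {linear U -> k^o}) :
  fd U -> fd V -> (forall u, f u = 0 -> phi u = 0) ->
  exists psi : {linear V -> k^o}, forall u, phi u = psi (f u).
Proof.
move=> [m /has_dim_iso [a [a' [aK a'K]]]] [n /has_dim_iso [b [b' [bK b'K]]]] f0.
have [M ME] := linear_mx (b' \o f \o a).
have [P PE] := form_mx (phi \o a).
exists (lin (@mx_form_linear V n b' (pinvmx M *m P))) => u /=.
rewrite -[u]a'K; move: (a' u) => x.
rewrite -[b' _]/((b' \o f \o a) x) ME -[LHS]/((phi \o a) x).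
have -> : ((x *m M) *m (pinvmx M *m P)) 0 0 = (phi \o a) (x *m M *m pinvmx M).
  by rewrite PE mulmxA.
apply/eqP; rewrite -subr_eq0 -linearB /= f0 //.
apply: (can_inj b'K); rewrite linear0 -[LHS]/((b' \o f \o a) _) ME mulmxBl.
by rewrite mulmxKpV ?subrr ?submxMl.
Qed.

(** * Pairings that are nondegenerate on one side *)

Section Pairing.
Variables (U V : lmodType k) (beta : U -> {linear V -> k^o}).
Hypothesis betaL : forall a u u' v,
  beta (a *: u + u') v = a * beta u v + beta u' v.
Hypothesis beta_nondeg : forall v, (forall u, beta u v = 0) -> v = 0.
Hypothesis U_fd : fd U.

(** The coordinates of v are its pairings with a basis of U, so nondegeneracy in v makes the map
    injective. A form on coordinates with coefficients x is the pairing with the combination of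
    basis vectors with coefficients x. *)
Lemma pairing_inj m : has_dim U m ->
  exists f : {linear V -> 'rV[k]_m}, injective f /\
  forall x : 'rV[k]_m, exists u, forall v, (f v *m x^T) 0 0 = beta u v.
Proof.
move=> Um; have [m' [e [c [Um' eE _]]]] := coords (ex_intro _ m Um).
have mm' := has_dim_uniq Um Um'; subst m'.
have beta0 v : beta 0 v = 0.
  by have := betaL (-1) 0 0 v; rewrite scaleN1r addNr mulN1r addNr.
have beta_sum (r : 'I_m -> k) v :
    beta (\sum_i r i *: e i) v = \sum_i r i * beta (e i) v.
  pose K u r := beta u v = r; rewrite -/(K _ _).
  apply: (big_ind2 K) => [|x1 x2 y1 y2 <- <-|i _]; rewrite /K ?beta0 //.
    by have := betaL 1 x1 y1 v; rewrite scale1r mul1r.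
  by rewrite -[_ *: _]addr0 betaL beta0 addr0.
have fL : linear (fun v => \row_i beta (e i) v).
  by move=> a u v; apply/rowP => i; rewrite !mxE linearP.
exists (lin fL); split=> [v v' /rowP fvv'|x].
  apply/eqP; rewrite -subr_eq0; apply/eqP/beta_nondeg => u.
  rewrite [u]eE beta_sum big1 // => i _.
  have := fvv' i; rewrite !mxE => bvv'.
  by rewrite linearB /= bvv' subrr mulr0.
exists (\sum_i x 0 i *: e i) => v; rewrite beta_sum mxE.
by apply: eq_bigr => i _; rewrite !mxE mulrC.
Qed.

Lemma pairing_dim_le m n : has_dim U m -> has_dim V n -> (n <= m)%N.
Proof.
move=> Um Vn; have [f [fI _]] := pairing_inj Um.
apply: (has_dim_inj Vn _ fI); exists idfun; exact: (Bijective (g := id)).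
Qed.

(** A form on V factors through the injection of [pairing_inj], and forms on the coordinates come
    from U. *)
Lemma pairing_repr : fd V -> forall phi : {linear V -> k^o},
  exists u, forall v, phi v = beta u v.
Proof.
move=> Vfd phi; have [m Um] := U_fd; have [f [fI fE]] := pairing_inj Um.
have mfd : fd 'rV[k]_m by exists m, idfun; exact: (Bijective (g := id)).
have [v|psi psiE] := @factor_form V _ f phi Vfd mfd.
  by rewrite -(linear0 f) => /fI ->; rewrite linear0.
have [P PE] := form_mx psi; have [u uE] := fE P^T.
by exists u => v; rewrite psiE PE -uE trmxK.
Qed.

End Pairing.

(** The generators are the rows of the kernel matrix; they come as a list because [kill_radical]
    consumes them one at a time. *)
Lemma kernel_span V d (f : {linear V -> 'rV[k]_d}) : fd V ->
  exists L : seq V, (forall v, List.In v L -> f v = 0) /\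
  forall Q : V -> Prop, Q 0 -> (forall a u v, Q u -> Q v -> Q (a *: u + v)) ->
    (forall v, List.In v L -> Q v) -> forall v, f v = 0 -> Q v.
Proof.
case=> n /has_dim_iso [a [b [aK bK]]]; have [M ME] := linear_mx (f \o a).
pose r i := a (row i (kermx M)).
exists (map r (enum 'I_n)); split=> [v /In_map [i [<- _]]|Q Q0 QL Qr v fv0].
  by rewrite -[f _]/((f \o a) _) ME -row_mul mulmx_ker row0.
have : (b v <= kermx M)%MS.
  by apply/sub_kermxP; rewrite -ME /= bK.
move=> /submxP [x bE]; rewrite -[v]bK bE mulmx_sum_row linear_sum.
elim/big_ind: _ => // [u u' Qu Qu'|i _]; first by rewrite -[u]scale1r; apply: QL.
rewrite linearZ /= -[_ *: _]addr0; apply: QL => //; apply: Qr.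
by apply/In_map; exists i; rewrite In_mem mem_enum.
Qed.

Lemma fbasis_ex V : exists ab : {linear 'rV[k]_(dimk V) -> V} *
    {linear V -> 'rV[k]_(dimk V)},
  fd V -> cancel ab.1 ab.2 /\ cancel ab.2 ab.1.
Proof.
case: (pselect (fd V)) => [Vfd|Vfd]; last first.
  by exists ((\0 : {linear _ -> _}), (\0 : {linear _ -> _})).
by have [a [b ab]] := has_dim_iso (dimkP Vfd); exists (a, b).
Qed.

(* Meaningful only for finite dimensional V; the maps are zero otherwise. *)
Definition fbasis V := sval (cid (fbasis_ex V)).

Lemma fbasisP V : fd V ->
  cancel (fbasis V).1 (fbasis V).2 /\ cancel (fbasis V).2 (fbasis V).1.
Proof. exact: (svalP (cid (fbasis_ex V))). Qed.

(** Measured in the fixed bases [fbasis], so that a map occurring in two neighbouring exactness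
    statements has the same rank in both. *)
Definition rk U V (f : {linear U -> V}) :=
  \rank (lin1_mx ((fbasis V).2 \o f \o (fbasis U).1)).

(** Rank-nullity: by exactness the row space of the matrix of [f] is the kernel of the matrix of
    [g]. *)
Lemma exact_dim U V W (f : {linear U -> V}) (g : {linear V -> W}) :
  fd U -> fd V -> fd W -> (forall u, g (f u) = 0) ->
  (forall v, g v = 0 -> exists u, v = f u) -> dimk V = (rk f + rk g)%N.
Proof.
move=> /fbasisP + /fbasisP + /fbasisP; rewrite /rk.
case: (fbasis U) (fbasis V) (fbasis W) => [a a'] [b b'] [c c'] /=.
move=> [aK a'K] [bK b'K] [cK c'K] gf gE.
set M := lin1_mx _; set N := lin1_mx _.
have ME x : b (x *m M) = f (a x) by rewrite mul_rV_lin1 /= b'K.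
have NE x : c (x *m N) = g (b x) by rewrite mul_rV_lin1 /= c'K.
have /eqmxP MN : (M == kermx N)%MS.
  apply/andP; split.
    apply/sub_kermxP/row_matrixP => i; rewrite row0; apply: (can_inj cK).
    by rewrite row_mul rowE NE ME gf linear0.
  apply/row_subP => i; have : g (b (row i (kermx N))) = 0.
    by rewrite -NE -row_mul mulmx_ker row0 linear0.
  case/gE => u uE; apply/submxP; exists (a' u); apply: (can_inj bK).
  by rewrite ME a'K.
rewrite MN mxrank_ker subnK //.
exact: rank_leq_row.
Qed.

End LinearAlgebra.

(** * Linear categories and dual objects *)

Local Open Scope cat_scope.

Section LcatTheory.
Variables (k : fieldType) (C : lcat k).
Implicit Types W X Y Z : C.

Definition postc W Y Z (g : hom Y Z) : {linear hom W Y -> hom W Z} :=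
  @lin k (hom W Y) (hom W Z) (comp g) (fun a f f' => comp_linr a g f f').

Definition prec X Y Z (f : hom X Y) : {linear hom Y Z -> hom X Z} :=
  @lin k (hom Y Z) (hom X Z) (fun g => g \oc f)
    (fun a g g' => comp_linl a g g' f).

Lemma comp0l X Y Z (f : hom X Y) : (0 : hom Y Z) \oc f = 0.
Proof. exact: (linear0 (prec Z f)). Qed.

Lemma comp0r X Y Z (g : hom Y Z) : g \oc (0 : hom X Y) = 0.
Proof. exact: (linear0 (postc X g)). Qed.

Lemma compNl X Y Z (g : hom Y Z) (f : hom X Y) : (- g) \oc f = - (g \oc f).
Proof. exact: (linearN (prec Z f)). Qed.

Lemma compNr X Y Z (g : hom Y Z) (f : hom X Y) : g \oc (- f) = - (g \oc f).
Proof. exact: (linearN (postc X g)). Qed.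

Lemma compDl X Y Z (g g' : hom Y Z) (f : hom X Y) :
  (g + g') \oc f = g \oc f + g' \oc f.
Proof. exact: (linearD (prec Z f)). Qed.

Lemma compDr X Y Z (g : hom Y Z) (f f' : hom X Y) :
  g \oc (f + f') = g \oc f + g \oc f'.
Proof. exact: (linearD (postc X g)). Qed.

Lemma compZl X Y Z a (g : hom Y Z) (f : hom X Y) :
  (a *: g) \oc f = a *: (g \oc f).
Proof. exact: (linearZ_LR (prec Z f)). Qed.

Lemma compZr X Y Z a (g : hom Y Z) (f : hom X Y) :
  g \oc (a *: f) = a *: (g \oc f).
Proof. exact: (linearZ_LR (postc X g)). Qed.

Lemma comp_suml X Y Z I (r : seq I) (g : I -> hom Y Z) (f : hom X Y) :
  (\sum_(i <- r) g i) \oc f = \sum_(i <- r) (g i \oc f).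
Proof. exact: (linear_sum (prec Z f)). Qed.

Lemma comp_sumr X Y Z I (r : seq I) (g : hom Y Z) (f : I -> hom X Y) :
  g \oc (\sum_(i <- r) f i) = \sum_(i <- r) (g \oc f i).
Proof. exact: (linear_sum (postc X g)). Qed.

Lemma isom_refl X : isom X X.
Proof. by exists (idm X), (idm X); rewrite comp1m. Qed.

Lemma isom_sym X Y : isom X Y -> isom Y X.
Proof. by move=> [f [g [gf fg]]]; exists g, f. Qed.

Lemma isom_trans Y X Z : isom X Y -> isom Y Z -> isom X Z.
Proof.
move=> [f [g [gf fg]]] [f' [g' [gf' fg']]]; exists (f' \oc f), (g \oc g').
split; first by rewrite compA -(compA g) gf' compm1.
by rewrite compA -(compA f') fg compm1.
Qed.

Definition op_cat : lcat k.
Proof.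
refine (@LCat k C (fun X Y => hom Y X) (fun X => idm X)
  (fun X Y Z g f => f \oc g) _ _ _ _ _) => *.
- exact/esym/compA.
- exact: compm1.
- exact: comp1m.
- exact: comp_linr.
- exact: comp_linl.
Defined.

End LcatTheory.

Lemma op_additive (k : fieldType) (C : lcat k) :
  additive_cat C -> additive_cat (op_cat C).
Proof.
move=> [[Z [Z0 Z0']] CD]; split; first by exists Z; split.
move=> X Y; have [S [i [j [p [q [pi qj qi pj ij]]]]]] := CD X Y.
by exists S, p, q, i, j.
Qed.

Section Nondegenerate.
Variables (k : fieldType) (C : lcat k).

Definition nondeg_src (X Z : C) (tau : {linear hom X Z -> k^o}) (Y : C) :=
  forall f : hom X Y, (forall g : hom Y Z, tau (g \oc f) = 0) -> f = 0.

Definition nondeg_tgt (X Z : C) (tau : {linear hom X Z -> k^o}) (Y : C) :=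
  forall g : hom Y Z, (forall f : hom X Y, tau (g \oc f) = 0) -> g = 0.

End Nondegenerate.

(** * Dual objects in a linear category; [G m q] stands for the q-th translate of the m-th member *)

Section Partner.
Variables (k : fieldType) (C : lcat k) (n : nat) (G : 'I_n -> int -> C).
Hypothesis C_add : additive_cat C.
Hypothesis C_fd : forall X Y : C, fd (hom X Y).
Hypothesis G_fin_to : forall m Z, exists s : seq int,
  forall q, q \notin s -> forall f : hom (G m q) Z, f = 0.
Hypothesis G_fin_from : forall m X, exists s : seq int,
  forall q, q \notin s -> forall f : hom X (G m q), f = 0.
Hypothesis G_triang : forall (l m : 'I_n) q p, (m < l)%N ->
  forall f : hom (G l q) (G m p), f = 0.
(** What is kept of the triangles: the cone of a nonzero map out of E_m[p], as seen by the members
    from m on. Phrased without a translation functor, it can be checked in the opposite category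
    too. *)
Hypothesis G_cone : forall m p Z (g : hom (G m p) Z), g != 0 ->
  exists Z' (j : hom Z Z'),
  [/\ j \oc g = 0,
      forall W (w : hom W Z), j \oc w = 0 -> exists w', w = g \oc w'
    & forall (l : 'I_n) q, (m <= l)%N ->
        forall w' : hom (G l q) Z', exists w, w' = j \oc w].

Variable X : C.

(* Z' is the sum of Z and of one copy of G m q for each form (q, la) in L: the
   inclusion of that copy represents la. *)
Lemma add_form (m : 'I_n) (Z : C) (tau : {linear hom X Z -> k^o})
    (L : seq {q : int & {linear hom X (G m q) -> k^o}}) :
  exists (Z' : C) (tau' : {linear hom X Z' -> k^o}) (i : hom Z Z') (r : hom Z' Z),
  [/\ r \oc i = idm Z, forall w, tau' (i \oc w) = tau w,
      forall (l : 'I_n) q, (m < l)%N ->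
        forall w' : hom (G l q) Z', exists w, w' = i \oc w
    & forall s, List.In s L -> exists g : hom (G m (tag s)) Z',
        forall f, tau' (g \oc f) = tagged s f].
Proof.
elim: L => [|[q la] L [Z1 [tau1 [i1 [r1 [ri1 tau1E surj1 L1]]]]]].
  exists Z, tau, (idm Z), (idm Z); split=> // [|w|l q _ w'].
  - exact: comp1m.
  - by rewrite comp1m.
  - by exists w'; rewrite comp1m.
have [S [i [j [p [r [pi rj ri pj ijE]]]]]] := C_add.2 Z1 (G m q).
have tauL : linear (fun w : hom X S => tau1 (p \oc w) + la (r \oc w) : k^o).
  move=> a u v; rewrite !comp_linr !linearP /= scalerDr.
  by rewrite !addrA; congr (_ + _); rewrite -!addrA; congr (_ + _); rewrite addrC.
exists S, (lin tauL), (i \oc i1), (r1 \oc p); split=> [|w|l q' ml w'|s].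
- by rewrite compA -(compA r1) pi compm1.
- rewrite /= -!compA (compA p) pi comp1m (compA r) ri comp0l linear0 addr0.
  exact: tau1E.
- have [w wE] := surj1 l q' ml (p \oc w'); exists w.
  rewrite -compA -wE compA -[LHS]comp1m -ijE compDl -(compA j).
  by rewrite [r \oc w'](G_triang ml) comp0r addr0.
case=> [<-|/L1[g gE]] /=.
  by exists j => f; rewrite /= !compA rj pj comp0l linear0 add0r comp1m.
exists (i \oc g) => f; rewrite /= !compA pi ri comp1m !comp0l linear0 addr0.
exact: gE.
Qed.

(** Only finitely many q carry nonzero maps, and for each of them the coordinate forms of a basis
    separate the elements. *)
Lemma separating_forms (m : 'I_n) :
  exists L : seq {q : int & {linear hom X (G m q) -> k^o}},
  forall q (f : hom X (G m q)), f <> 0 ->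
    exists la, List.In (existT _ q la) L /\ la f <> 0.
Proof.
have [s sP] := G_fin_from m X.
suff [L LP] : exists L : seq {q : int & {linear hom X (G m q) -> k^o}},
    forall q, q \in s -> forall f : hom X (G m q), f <> 0 ->
    exists la, List.In (existT _ q la) L /\ la f <> 0.
  exists L => q f; have [qs|/sP f0] := boolP (q \in s); first exact: LP.
  by rewrite (f0 f).
elim: s {sP} => [|q s [L LP]]; first by exists [::].
have [d [e [c [_ vE _]]]] := coords (C_fd X (G m q)).
exists ([seq existT _ q (c i) | i <- enum 'I_d] ++ L) => q'.
rewrite inE => /predU1P[-> f f0|q's f f0]; last first.
  have [la [Lla laf]] := LP _ q's f f0; exists la; split=> //.
  by apply/In_cat; right.
have [i ci] : exists i, c i f <> 0.
  apply: contra_notP f0 => /forallNP cf0; rewrite [f]vE big1 // => i _.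
  by have /contrapT -> := cf0 i; rewrite scale0r.
exists (c i); split=> //; apply/In_cat; left.
by apply/In_map; exists i; rewrite In_mem mem_enum.
Qed.

Definition radical (m : 'I_n) (Z : C) (tau : {linear hom X Z -> k^o}) q
  (w : hom (G m q) Z) := forall f, tau (w \oc f) = 0.

(* Span is expressed by families of subspaces Q, so that elements of different
   degrees q are never compared. *)
Definition spans_radical (m : 'I_n) (Z : C) (tau : {linear hom X Z -> k^o})
    (L : seq {q : int & hom (G m q) Z}) :=
  forall Q : forall q, hom (G m q) Z -> Prop,
    (forall q, Q q 0) ->
    (forall q a u v, Q q u -> Q q v -> Q q (a *: u + v)) ->
    (forall s, List.In s L -> Q (tag s) (tagged s)) ->
    forall q w, radical tau w -> Q q w.

(** In each of the finitely many relevant degrees the radical is the kernel of w -> (tau (w e_i))_i,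
    for a basis e_i of Hom(X, G m q). *)
Lemma radical_span (m : 'I_n) (Z : C) (tau : {linear hom X Z -> k^o}) :
  exists L : seq {q : int & hom (G m q) Z},
  (forall s, List.In s L -> radical tau (tagged s)) /\ spans_radical tau L.
Proof.
have [s sP] := G_fin_to m Z.
suff [L [Lrad LP]] : exists L : seq {q : int & hom (G m q) Z},
    (forall s, List.In s L -> radical tau (tagged s)) /\
    forall Q : forall q, hom (G m q) Z -> Prop,
    (forall q, Q q 0) ->
    (forall q a u v, Q q u -> Q q v -> Q q (a *: u + v)) ->
    (forall s, List.In s L -> Q (tag s) (tagged s)) ->
    forall q, q \in s -> forall w, radical tau w -> Q q w.
  exists L; split=> // Q Q0 QL QS q w; have [qs|/sP w0 _] := boolP (q \in s).
    exact: LP.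
  by rewrite (w0 w); apply: Q0.
elim: s {sP} => [|q s [L [Lrad LP]]]; first by exists [::].
have [d [e [c [_ vE _]]]] := coords (C_fd X (G m q)).
have TL : linear (fun w : hom (G m q) Z => \row_i (tau (w \oc e i) : k)).
  by move=> a u v; apply/rowP => i; rewrite !mxE comp_linl linearP.
have [L' [L'ker L'P]] := kernel_span (lin TL) (C_fd (G m q) Z).
have radE (w : hom (G m q) Z) : radical tau w <-> lin TL w = 0.
  split=> [w0|/rowP w0 f]; first by apply/rowP => i; rewrite !mxE w0.
  rewrite [f]vE comp_sumr linear_sum big1 // => i _.
  by rewrite compZr lformZ; have := w0 i; rewrite !mxE => ->; rewrite mulr0.
exists ([seq existT _ q v | v <- L'] ++ L); split=> [t|Q Q0 QL QS q'].
  by case/In_cat => [/In_map [v [<- /L'ker/radE]]|/Lrad].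
rewrite inE => /predU1P[-> w /radE|q's w]; last first.
  by apply: LP => // t Lt; apply: QS; apply/In_cat; right.
apply: (L'P (Q q)) => // [|v L'v]; first exact: QL.
apply: (QS (existT _ q v)); apply/In_cat; left.
by apply/In_map; exists v.
Qed.

(* Taking the cone of one radical map g : G m p -> Z at a time; the form tau
   descends to the cone because it vanishes on the maps that factor through g. *)
Lemma kill_radical (m : 'I_n) (Z : C) (tau : {linear hom X Z -> k^o})
    (L : seq {q : int & hom (G m q) Z}) :
  (forall s, List.In s L -> radical tau (tagged s)) -> spans_radical tau L ->
  exists (Z' : C) (tau' : {linear hom X Z' -> k^o}) (j : hom Z Z'),
  [/\ forall w, tau' (j \oc w) = tau w,
      forall (l : 'I_n) q, (m <= l)%N ->
        forall w' : hom (G l q) Z', exists w, w' = j \oc w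
    & forall q, nondeg_tgt tau' (G m q)].
Proof.
have [s] := ubnP (size L); elim: s => // s IHs in Z tau L *.
case: L => [|[p g] L] /= sL Lrad Lspan.
  exists Z, tau, (idm Z); split=> [w|l q _ w'|q w].
  - by rewrite comp1m.
  - by exists w'; rewrite comp1m.
  (* With no generators left, the radical lies in the zero subspace. *)
  by apply: (Lspan (fun q w => w = 0)) => // r a u v -> ->; rewrite scaler0 addr0.
have [g0|/eqP g0] := eqVneq g 0.
  apply: (IHs _ _ L) => // [t Lt|Q Q0 QL QS].
    by apply: Lrad; right.
  by apply: Lspan => // t [<-|/QS//]; rewrite /= g0.
have [|Z1 [j [jg jE jsurj]]] := @G_cone m p Z g; first exact/eqP.
(* A map X -> Z1 need not come from Z; [factor_form] supplies some extension of the form to all of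
   Hom(X, Z1). *)
have [f|tau1 tau1E] := @factor_form k _ _ (postc X j) tau (C_fd _ _) (C_fd _ _).
  move=> /= /jE [f' ->]; apply: (Lrad (existT _ p g)); by left.
have tau1E' w : tau1 (j \oc w) = tau w by rewrite tau1E.
have [|||Z' [tau' [j' [tau'E j'surj nd]]]] :=
  IHs _ tau1 [seq existT _ (tag t) (j \oc tagged t) | t <- L].
- by rewrite size_map.
- move=> t /In_map [u [<- Lu]] f.
  by rewrite /= -compA tau1E'; apply: (Lrad u); right.
- move=> Q Q0 QL QS q w' w'rad; have [w wE] := jsurj m q (leqnn _) w'.
  rewrite {w'}wE in w'rad *.
  (* The pullback of [Q] along [j] contains the removed generator because j g = 0, so the images of
     the remaining ones span the new radical. *)
  apply: (Lspan (fun q w => Q q (j \oc w))) => [r|r a u v Qu Qv|t|f].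
  + by rewrite comp0r.
  + by rewrite comp_linr; apply: QL.
  + case=> [<-|Lt] /=; first by rewrite jg.
    apply: (QS (existT _ (tag t) (j \oc tagged t))).
    by apply/In_map; exists t.
  + by rewrite -tau1E' compA.
exists Z', tau', (j' \oc j); split=> [w|l q ml w'|//].
  by rewrite -compA tau'E.
have [w1 ->] := j'surj l q ml w'; have [w ->] := jsurj l q ml w1.
by exists w; rewrite compA.
Qed.

(* Downward induction on l: adding copies of G l q makes the pairing nondegenerate
   on the side of X, killing the radical makes it so on the side of Z, and by
   triangularity neither step disturbs the G l' q with l < l'. *)
Lemma partner_ex : exists (Z : C) (tau : {linear hom X Z -> k^o}),
  forall l q, nondeg_src tau (G l q) /\ nondeg_tgt tau (G l q).
Proof.
suff main m : (m <= n)%N -> exists (Z : C) (tau : {linear hom X Z -> k^o}),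
    forall (l : 'I_n) q, (n <= l + m)%N ->
    nondeg_src tau (G l q) /\ nondeg_tgt tau (G l q).
  have [Z [tau tauP]] := main n (leqnn n).
  by exists Z, tau => l q; apply: tauP; rewrite leq_addl.
elim: m => [_|m IHm mn].
  have [Z _] := C_add.1; exists Z, \0 => l q.
  by rewrite addn0 leqNgt ltn_ord.
have [Z [tau tauP]] := IHm (ltnW mn).
have m0n : (n - m.+1 < n)%N by rewrite -subSn // subSS leq_subr.
pose m0 := Ordinal m0n.
have m0l (l : 'I_n) : (m0 < l)%N -> (n <= l + m)%N.
  by rewrite /= subnSK // leq_subLR addnC.
have [L LP] := separating_forms m0.
have [Z1 [tau1 [i [r [ri tau1E isurj L1]]]]] := add_form tau L.
have [L' [L'rad L'P]] := radical_span m0 tau1.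
have [Z2 [tau2 [j [tau2E jsurj nd]]]] := kill_radical L'rad L'P.
exists Z2, tau2 => l q ln.
have m0_le : (m0 <= l)%N by rewrite /= leq_subLR addnC.
have src1 : nondeg_src tau1 (G l q).
  move=> f f0; have [lm0|m0l'] := eqVneq l m0.
    subst l; apply: contrapT => /LP [la [/L1 [g gE] laf]].
    by apply: laf; rewrite -[la f]gE f0.
  have m0_lt : (m0 < l)%N by rewrite ltn_neqAle eq_sym m0l'.
  have [src _] := tauP l q (m0l l m0_lt).
  by apply: src => g; rewrite -tau1E compA f0.
split=> [f f0|g]; first by apply: src1 => g; rewrite -tau2E compA f0.
have [lm0|m0l'] := eqVneq l m0; first by subst l; apply: nd.
have m0_lt : (m0 < l)%N by rewrite ltn_neqAle eq_sym m0l'.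
have [w ->] := jsurj l q m0_le g; have [w' ->] := isurj l q m0_lt w.
have [_ tgt] := tauP l q (m0l _ m0_lt).
move=> g0; rewrite (tgt w') ?comp0r // => f.
by rewrite -tau1E -tau2E (compA i) (compA j) g0.
Qed.

End Partner.

(** * Triangulated categories *)

Section LinearBijections.
Variable k : fieldType.
Implicit Types U V W : lmodType k.

Definition lbij U V := exists f : {linear U -> V}, bijective f.

Lemma lbij_sym U V : lbij U V -> lbij V U.
Proof. by case=> f /lin_inv [g [fK gK]]; exists g, f. Qed.

Lemma lbij_trans V U W : lbij U V -> lbij V W -> lbij U W.
Proof.
by move=> [f fB] [g gB]; exists (g \o f : {linear _ -> _}); apply: bij_comp.
Qed.

Lemma lbij_dimk U V : lbij U V -> dimk U = dimk V.
Proof. by case=> f /dimk_bij. Qed.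

Lemma lbij_all0 U V : lbij U V -> (forall u : U, u = 0) -> forall v : V, v = 0.
Proof. by move=> [f [g _ gK]] U0 v; rewrite -[v]gK [g v]U0 linear0. Qed.

Lemma lbij_hom (C : lcat k) (X X' Y Y' : C) :
  isom X X' -> isom Y Y' -> lbij (hom X Y) (hom X' Y').
Proof.
move=> [a [a' [a'a aa']]] [b [b' [b'b bb']]].
exists (postc X' b \o prec Y a' : {linear _ -> _}).
exists (postc X b' \o prec Y' a) => f /=.
  by rewrite -!compA a'a compm1 compA b'b comp1m.
by rewrite -!compA aa' compm1 compA bb' comp1m.
Qed.

End LinearBijections.

Section Triangulated.
Variables (k : fieldType) (D : tricat k).
Implicit Types W X Y Z A B : D.
Local Notation "f [1]" := (fmap (@shift k D) f) (at level 2, format "f [1]").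
Local Notation S := (@shift k D).

Lemma shift_full X Y (g : hom (S X) (S Y)) : exists f : hom X Y, f[1] = g.
Proof. by have [f' _ f'K] := (shift_equiv D).1 X Y; exists (f' g). Qed.

Lemma shift_faithful X Y : injective (fun f : hom X Y => f[1]).
Proof. by have [f' fK _] := (shift_equiv D).1 X Y; apply: can_inj fK. Qed.

Lemma shift0 X Y : (0 : hom X Y)[1] = 0.
Proof. exact: linear0. Qed.

Lemma shiftN X Y (f : hom X Y) : (- f)[1] = - f[1].
Proof. exact: linearN. Qed.

Lemma zero_objP Z : zero_obj Z <-> idm Z = 0.
Proof.
split=> [[Z0 _]|Z0]; first exact: Z0.
by split=> X f; [rewrite -[f]compm1|rewrite -[f]comp1m]; rewrite Z0 ?comp0l ?comp0r.
Qed.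

Lemma shift_zero_obj Z : zero_obj Z -> zero_obj (S Z).
Proof. by move=> /zero_objP Z0; apply/zero_objP; rewrite -fmap1 Z0 shift0. Qed.

Lemma dist_comp0 X Y Z (f : hom X Y) (g : hom Y Z) (h : hom Z (S X)) :
  dist f g h -> g \oc f = 0.
Proof.
move=> fgh; have [Z0 Z00] := (tcat_additive D).1.
have [|c [<- _]] := dist_morph (a := idm X) (b := f) (dist_id X Z00) fgh.
  by [].
by rewrite comp0r.
Qed.

(** Completing the square of [w] and 0 to a morphism from the triangle W -> 0 -> W[1] to Y -> Z ->
    X[1] gives a map W[1] -> X[1]; its desuspension is the factorization. *)
Lemma dist_cov X Y Z (f : hom X Y) (g : hom Y Z) (h : hom Z (S X)) W
    (w : hom W Y) :
  dist f g h -> g \oc w = 0 -> exists w', w = f \oc w'.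
Proof.
move=> /dist_rot fgh gw; have [Z0 Z00] := (tcat_additive D).1.
have /dist_rot idW := dist_id W Z00.
have [|c [_ E]] := dist_morph (a := w) (b := (0 : hom Z0 Z)) idW fgh.
  by rewrite gw comp0l.
have [w' w'E] := shift_full c; exists w'; apply: shift_faithful.
rewrite fmapM w'E; apply: oppr_inj.
by rewrite -compNl -E fmap1 compNr compm1.
Qed.

Lemma dist_con X Y Z (f : hom X Y) (g : hom Y Z) (h : hom Z (S X)) W
    (w : hom Y W) :
  dist f g h -> w \oc f = 0 -> exists w', w = w' \oc g.
Proof.
move=> fgh wf; have [Z0 Z00] := (tcat_additive D).1.
have zW : dist (0 : hom Z0 W) (idm W) (0 : hom W (S Z0)).
  by apply/dist_rot; rewrite shift0 oppr0; apply/dist_id/shift_zero_obj.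
have [|c [E _]] := dist_morph (a := (0 : hom X Z0)) (b := w) fgh zW.
  by rewrite wf comp0l.
by exists c; rewrite E comp1m.
Qed.

Lemma dist_rot2 X Y Z (f : hom X Y) (g : hom Y Z) (h : hom Z (S X)) :
  dist f g h -> dist h (- f[1]) (- g[1]).
Proof. by move/dist_rot/dist_rot. Qed.

Lemma dist_rot3 X Y Z (f : hom X Y) (g : hom Y Z) (h : hom Z (S X)) :
  dist f g h -> dist (- f[1]) (- g[1]) (- h[1]).
Proof. by move/dist_rot2/dist_rot. Qed.

(** The diagram chases are run on maps from an arbitrary W. Lifting the identity gives a right
    inverse d of [c], and injectivity applied to d c - 1 makes it two-sided. *)
Lemma dist_five X Y Z X' Y' Z' (f : hom X Y) (g : hom Y Z) (h : hom Z (S X))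
    (f' : hom X' Y') (g' : hom Y' Z') (h' : hom Z' (S X'))
    (a : hom X X') (b : hom Y Y') (c : hom Z Z') :
  dist f g h -> dist f' g' h' -> is_iso a -> is_iso b ->
  b \oc f = f' \oc a -> c \oc g = g' \oc b -> a[1] \oc h = h' \oc c -> is_iso c.
Proof.
move=> fgh fgh' [a' [a'a aa']] [b' [b'b bb']] E1 E2 E3.
have a'a1 : a'[1] \oc a[1] = idm _ by rewrite -fmapM a'a fmap1.
have aa'1 : a[1] \oc a'[1] = idm _ by rewrite -fmapM aa' fmap1.
have b'b1 : b'[1] \oc b[1] = idm _ by rewrite -fmapM b'b fmap1.
have inj W (w : hom W Z) : c \oc w = 0 -> w = 0.
  move=> cw; have hw : h \oc w = 0.
    by rewrite -[h \oc w]comp1m -a'a1 -compA (compA a[1]) E3 -compA cw !comp0r.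
  have /dist_rot rot := fgh; have [w1 w1E] := dist_cov rot hw.
  have : g' \oc (b \oc w1) = 0 by rewrite compA -E2 -compA -w1E.
  move=> /(dist_cov fgh') [v vE].
  have w1E' : w1 = f \oc (a' \oc v).
    rewrite -[w1]comp1m -b'b -compA vE -[v in LHS]comp1m -aa' -(compA a).
    by rewrite (compA f') -E1 !compA b'b comp1m.
  by rewrite w1E w1E' compA (dist_comp0 fgh) comp0l.
have surj W (w' : hom W Z') : exists w, w' = c \oc w.
  pose x := a'[1] \oc h' \oc w'.
  have ax : a[1] \oc x = h' \oc w' by rewrite /x !compA aa'1 comp1m.
  have fx : - f[1] \oc x = 0.
    rewrite -[LHS]comp1m -b'b1 -compA compNl compNr (compA b[1]) -fmapM E1.
    rewrite fmapM -compA ax compA.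
    have /dist_rot/dist_rot/dist_comp0 := fgh'; rewrite compNl => /eqP.
    by rewrite oppr_eq0 => /eqP ->; rewrite comp0l oppr0 comp0r.
  have [y yE] := dist_cov (dist_rot2 fgh) fx.
  have: h' \oc (w' - c \oc y) = 0.
    by rewrite compDr compNr (compA h') -E3 -compA -yE ax subrr.
  have /dist_rot rot := fgh'; move=> /(dist_cov rot) [v vE].
  exists (y + g \oc (b' \oc v)); rewrite compDr compA E2 -compA (compA b) bb'.
  by rewrite comp1m -vE addrC subrK.
have [d dE] := surj _ (idm Z'); exists d; split=> //.
apply/eqP; rewrite -subr_eq0; apply/eqP/inj.
by rewrite compDr compNr compA -dE comp1m compm1 subrr.
Qed.

Lemma isom_shift X Y : isom X Y -> isom (S X) (S Y).
Proof.
by move=> [f [g [gf fg]]]; exists f[1], g[1]; rewrite -!fmapM gf fg !fmap1.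
Qed.

Lemma isom_shift_inv X Y : isom (S X) (S Y) -> isom X Y.
Proof.
move=> [f [g [gf fg]]]; have [f' fE] := shift_full f.
have [g' gE] := shift_full g; exists f', g'; split; apply: shift_faithful.
  by rewrite fmapM fE gE gf fmap1.
by rewrite fmapM fE gE fg fmap1.
Qed.

Lemma isom_unshift X Y : isom X Y -> isom (unshift X) (unshift Y).
Proof.
move=> XY; apply: isom_shift_inv; apply: isom_trans (unshiftP X) _.
exact: isom_trans XY (isom_sym (unshiftP Y)).
Qed.

Lemma unshift_shift X : isom (unshift (S X)) X.
Proof. exact/isom_shift_inv/unshiftP. Qed.

Definition triangle X Y Z :=
  exists (f : hom X Y) (g : hom Y Z) (h : hom Z (S X)), dist f g h.

Lemma is_iso_id X : is_iso (idm X).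
Proof. by exists (idm X); rewrite comp1m. Qed.

Lemma triangle_isom X Y Z X' Y' Z' : isom X X' -> isom Y Y' -> isom Z Z' ->
  triangle X Y Z -> triangle X' Y' Z'.
Proof.
move=> [a [a' [a'a aa']]] [b [b' [b'b bb']]] [c [c' [c'c cc']]].
move=> [f [g [h fgh]]].
exists (b \oc f \oc a'), (c \oc g \oc b'), (a[1] \oc h \oc c').
apply: (dist_iso (a := a) (b := b) (c := c)) fgh;
  [by exists a'|by exists b'|by exists c'| | |].
- by rewrite -!compA a'a compm1.
- by rewrite -!compA b'b compm1.
- by rewrite -!compA c'c compm1.
Qed.

Lemma triangle_shift X Y Z : triangle X Y Z -> triangle (S X) (S Y) (S Z).
Proof. by move=> [f [g [h /dist_rot3 ?]]]; exists (- f[1]), (- g[1]), (- h[1]). Qed.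

(** [unshift] is chosen on objects only. A desuspension [f1] of the first map is completed to a
    triangle; three rotations introduce signs, absorbed by taking - b, and [dist_five] then compares
    it with the given triangle. *)
Lemma triangle_unshift X Y Z :
  triangle X Y Z -> triangle (unshift X) (unshift Y) (unshift Z).
Proof.
move=> [f [g [h fgh]]].
have [a [a' [a'a aa']]] := unshiftP X; have [b [b' [b'b bb']]] := unshiftP Y.
have [f1 f1E] := shift_full (b' \oc f \oc a).
have [Z1 [g1 [h1 fgh1]]] := dist_cone f1.
have E1 : (- b) \oc - f1[1] = f \oc a.
  by rewrite compNl compNr opprK f1E !compA bb' comp1m.
have [c [E2 E3]] := dist_morph (dist_rot3 fgh1) fgh E1.
have c_iso : is_iso c.
  apply: dist_five (dist_rot3 fgh1) fgh _ _ E1 E2 E3; first by exists a'.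
  by exists (- b'); rewrite !compNl !compNr !opprK.
have Z1Z : isom Z1 (unshift Z).
  apply: isom_shift_inv; apply: isom_trans (isom_sym (unshiftP Z)).
  by exists c.
by apply: triangle_isom (isom_refl _) (isom_refl _) Z1Z _; exists f1, g1, h1.
Qed.

Lemma triangle_shiftn X Y Z p :
  triangle X Y Z -> triangle (shiftn X p) (shiftn Y p) (shiftn Z p).
Proof.
case: p => n tri /=.
  by elim: n => //= n; apply: triangle_shift.
by apply: triangle_unshift; elim: n => //= n; apply: triangle_unshift.
Qed.

Lemma dist_cocone Z A (g : hom Z A) :
  exists Z' (j : hom Z' Z) (h : hom A (S Z')), dist j g h.
Proof.
have [B [a [b gab]]] := dist_cone g.
have [c [c' [c'c cc']]] := unshiftP B; have [j jE] := shift_full (b \oc c).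
exists (unshift B), (- j), (c' \oc a); apply/dist_rot; rewrite shiftN opprK.
apply: (dist_iso (a := idm Z) (b := idm A) (c := c')) gab;
  [exact: is_iso_id|exact: is_iso_id|by exists c| | |].
- by rewrite comp1m compm1.
- by rewrite compm1.
- by rewrite fmap1 comp1m jE -compA cc' compm1.
Qed.

Lemma NegzS1 n : Negz n + 1 = - n%:Z.
Proof. by rewrite NegzE -addn1 PoszD opprD addrNK. Qed.

Lemma shiftnS X p : isom (S (shiftn X p)) (shiftn X (p + 1)).
Proof.
case: p => n; first by rewrite -PoszD addn1; apply: isom_refl.
rewrite NegzS1; case: n => [|n]; first exact: unshiftP.
rewrite -NegzE; exact: unshiftP.
Qed.

Lemma isom_shiftn X Y p : isom X Y -> isom (shiftn X p) (shiftn Y p).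
Proof.
case: p => n XY /=.
  by elim: n => //= n; apply: isom_shift.
by apply: isom_unshift; elim: n => //= n; apply: isom_unshift.
Qed.

Lemma shiftn_shift X p : isom (shiftn (S X) p) (shiftn X (p + 1)).
Proof.
case: p => n; first by rewrite -PoszD addn1 /= -iterSr; apply: isom_refl.
rewrite [shiftn _ _]iterSr.
rewrite NegzS1; case: n => [|n]; first exact: unshift_shift.
rewrite -NegzE; exact: (isom_shiftn (Negz n) (unshift_shift X)).
Qed.

Lemma shiftn_unshift X p : isom (shiftn (unshift X) p) (shiftn X (p - 1)).
Proof.
rewrite -[p in shiftn (unshift _) p](subrK 1).
exact: isom_trans (isom_sym (shiftn_shift _ _)) (isom_shiftn _ (unshiftP X)).
Qed.

Lemma lbij_shift X Y : lbij (hom X Y) (hom (S X) (S Y)).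
Proof. by exists (@fmap _ _ _ S X Y); apply: (shift_equiv D).1. Qed.

Lemma lbij_shiftn X Y p q r :
  lbij (hom (shiftn X p) (shiftn Y q)) (hom (shiftn X (p + r)) (shiftn Y (q + r))).
Proof.
have pos (n : nat) p' q' : lbij (hom (shiftn X p') (shiftn Y q'))
    (hom (shiftn X (p' + n)) (shiftn Y (q' + n))).
  elim: n => [|n IHn]; first by rewrite !addr0; exists idfun; exact: (Bijective (g := id)).
  apply: lbij_trans IHn _; apply: lbij_trans (lbij_shift _ _) _.
  by rewrite -addn1 PoszD !addrA; apply: lbij_hom; apply: shiftnS.
case: r => n; first exact: pos.
apply: lbij_sym.
have := pos n.+1 (p + Negz n) (q + Negz n).
by rewrite NegzE !addrNK.
Qed.

Lemma lbij_shiftn_l X Y p : lbij (hom (shiftn X p) Y) (hom X (shiftn Y (- p))).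
Proof. by have := lbij_shiftn X Y p 0 (- p); rewrite subrr add0r. Qed.

(** Nonnegative iterates of the translation act on maps as well, so the long exact sequences behind
    the Euler form are taken between them. *)
Lemma lbij_iter_shift X Y (n m : nat) :
  lbij (hom X (shiftn Y (m%:Z - n%:Z))) (hom (iter n S X) (iter m S Y)).
Proof. by have := lbij_shiftn X Y 0 (m%:Z - n%:Z) n; rewrite add0r subrK. Qed.

Section FiniteType.
Hypothesis D_fin : finite_type D.

Lemma hom_fd X Y : fd (hom X Y).
Proof. exact: ((D_fin X Y).1 0). Qed.

Lemma fin_support X Y : exists s : seq int,
  forall q, q \notin s -> forall f : hom X (shiftn Y q), f = 0.
Proof.
have [_ /finite_seqP [s sE]] := D_fin X Y; exists s => q qs f.
apply/eqP; apply: contraNT qs => f0.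
suff : [set p | exists f : hom X (shiftn Y p), f != 0]%classic q by rewrite sE.
by exists f.
Qed.

Lemma fin_support_l X Y : exists s : seq int,
  forall q, q \notin s -> forall f : hom (shiftn X q) Y, f = 0.
Proof.
have [s sP] := fin_support X Y; exists (map -%R s) => q qs.
apply: lbij_all0 (lbij_sym (lbij_shiftn_l X Y q)) _; apply: sP.
by apply: contra qs => qs; rewrite -[q]opprK map_f.
Qed.

End FiniteType.

End Triangulated.

(** * The Serre functor *)

Section SerrePairs.
Variables (k : fieldType) (D : tricat k).
Hypothesis D_fin : finite_type D.
Implicit Types W X Y Z A B : D.
Local Notation "f [1]" := (fmap (@shift k D) f) (at level 2, format "f [1]").
Local Notation S := (@shift k D).

(** * Cones and cocones of maps from and to members of an exceptional collection *)

Section Cones.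
Variables (n : nat) (E : 'I_n -> D).
Hypothesis E_exc : exc_collection E.
Local Notation G := (fun m q => shiftn (E m) q).

Lemma lbij_shiftn2 X Y q p :
  lbij (hom (shiftn X q) (shiftn Y p)) (hom X (shiftn Y (p - q))).
Proof. by have := lbij_shiftn X Y q p (- q); rewrite subrr. Qed.

Lemma exc_triang (l m : 'I_n) q p : (m < l)%N ->
  forall f : hom (G l q) (G m p), f = 0.
Proof.
move=> ml; apply: lbij_all0 (lbij_sym (lbij_shiftn2 _ _ _ _)) _.
exact: E_exc.2.
Qed.

Lemma exc_neq (m : 'I_n) q p : p != q -> forall f : hom (G m q) (G m p), f = 0.
Proof.
move=> pq; apply: lbij_all0 (lbij_sym (lbij_shiftn2 _ _ _ _)) _.
by have [+ _ _] := E_exc.1 m; apply; rewrite subr_eq0.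
Qed.

(** The linear bijection with End(E_m) may not match the identities; the identity corresponds to
    some multiple a. If a = 0 all maps vanish, otherwise one divides by a. *)
Lemma exc_scalar (m : 'I_n) q (f : hom (G m q) (G m q)) :
  exists a, f = a *: idm _.
Proof.
have [phi [phi' phiK phi'K]] := lbij_shiftn (E m) (E m) 0 0 q.
rewrite !add0r in phi phi' phiK phi'K; have [_ _ sc] := E_exc.1 m.
have [a aE] := sc (phi' (idm _)); have [b bE] := sc (phi' f).
have idE : idm (G m q) = a *: phi (idm _) by rewrite -linearZ -aE phi'K.
have [a0|a0] := eqVneq a 0.
  by exists 0; rewrite -[f]compm1 idE a0 !scale0r comp0r.
exists (b / a).
by rewrite idE scalerA divfK // -linearZ -bE phi'K.
Qed.

Lemma exc_shift_scalar (m : 'I_n) q : exists th : hom (G m (q + 1)) (S (G m q)),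
  is_iso th /\ forall f, exists a, f = a *: th.
Proof.
have [th [th' [th'th thth']]] := isom_sym (shiftnS (E m) q).
exists th; split=> [|f]; first by exists th'.
have [g gE] := shift_full (f \oc th'); have [a aE] := exc_scalar g.
exists a; rewrite -[f]compm1 -th'th compA -gE aE linearZ /= fmap1 compZl.
by rewrite comp1m.
Qed.

Lemma exc_hom_shift0 (l m : 'I_n) q p :
  (m < l)%N \/ (l = m /\ q != p + 1) -> forall f : hom (G l q) (S (G m p)), f = 0.
Proof.
move=> lm; apply: lbij_all0 (lbij_sym (lbij_hom (isom_refl _) (shiftnS _ _))) _.
by case: lm => [/exc_triang|[-> qp]]; [apply|apply: exc_neq; rewrite eq_sym].
Qed.

(** A map E_l[q] -> Z' lifts to Z once its composite into E_m[p][1] vanishes. Exceptionality leaves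
    only the case l = m, q = p + 1, where the composite is a scalar times an isomorphism; g[1] kills
    it and g is nonzero, so the scalar is 0. *)
Lemma exc_cone m p Z (g : hom (G m p) Z) : g != 0 ->
  exists Z' (j : hom Z Z'),
  [/\ j \oc g = 0,
      forall W (w : hom W Z), j \oc w = 0 -> exists w', w = g \oc w'
    & forall (l : 'I_n) q, (m <= l)%N ->
        forall w' : hom (G l q) Z', exists w, w' = j \oc w].
Proof.
move=> g0; have [Z' [j [h gjh]]] := dist_cone g.
exists Z', j; split=> [|W w|l q ml w']; first exact: dist_comp0 gjh.
  exact: dist_cov gjh.
have /dist_rot jh := gjh; apply: (dist_cov jh).
move: ml; rewrite leq_eqVlt => /orP[/eqP/val_inj ml|ml]; last first.
  by apply: exc_hom_shift0; left.
subst l; have [qp|qp] := eqVneq q (p + 1); last by apply: exc_hom_shift0; right.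
subst q; have [th [[th' [_ thth']] /(_ (h \oc w')) [a aE]]] := exc_shift_scalar m p.
have := dist_comp0 (dist_rot2 gjh); rewrite compNl => /eqP.
rewrite oppr_eq0 => /eqP gh.
have /eqP : a *: g[1] = 0.
  by rewrite -[g[1]]compm1 -thth' compA -compZl -compZr -aE compA gh !comp0l.
rewrite scaler_eq0 => /orP[/eqP a0|/eqP g1]; first by rewrite aE a0 scale0r.
by case/eqP: g0; apply: shift_faithful; rewrite g1 shift0.
Qed.

(** Dual to [exc_cone], this provides [G_cone] for the opposite category with the members in reverse
    order. *)
Lemma exc_cocone m p Z (g : hom Z (G m p)) : g != 0 ->
  exists Z' (j : hom Z' Z),
  [/\ g \oc j = 0,
      forall W (w : hom Z W), w \oc j = 0 -> exists w', w = w' \oc g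
    & forall (l : 'I_n) q, (l <= m)%N ->
        forall w' : hom Z' (G l q), exists w, w' = w \oc j].
Proof.
move=> g0; have [Z' [j [h jgh]]] := dist_cocone g.
exists Z', j; split=> [|W w|l q lm w']; first exact: dist_comp0 jgh.
  exact: dist_con jgh.
suff wh : w'[1] \oc h = 0.
  have [x xE] := dist_con (dist_rot2 jgh) wh; have [y yE] := shift_full x.
  exists (- y); apply: shift_faithful.
  by rewrite xE fmapM shiftN yE compNl compNr.
move: lm; rewrite leq_eqVlt => /orP[/eqP/val_inj lm|lm]; last first.
  by apply: exc_hom_shift0; left.
subst l; have [pq|pq] := eqVneq p (q + 1); last by apply: exc_hom_shift0; right.
subst p; have [th [[th' [th'th _]] /(_ (w'[1] \oc h)) [a aE]]] := exc_shift_scalar m q.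
have /dist_rot/dist_comp0 hg := jgh.
have /eqP : a *: g = 0.
  by rewrite -[g]comp1m -th'th -compA -compZr -compZl -aE -compA hg !comp0r.
rewrite scaler_eq0 => /orP[/eqP a0|/eqP g1]; first by rewrite aE a0 scale0r.
by case/eqP: g0.
Qed.

End Cones.

(** * Nondegenerate trace pairings and their behaviour in triangles *)

Section Nondeg.
Variables (X Z : D) (tau : {linear hom X Z -> k^o}).

Definition nondeg Y := nondeg_src tau Y /\ nondeg_tgt tau Y.

Definition tau_src Y (f : hom X Y) : {linear hom Y Z -> k^o} := tau \o prec Z f.
Definition tau_tgt Y (g : hom Y Z) : {linear hom X Y -> k^o} := tau \o postc X g.

Lemma tau_srcL Y a (f f' : hom X Y) g :
  tau_src (a *: f + f') g = a * tau_src f g + tau_src f' g.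
Proof. by rewrite /= comp_linr linearP. Qed.

Lemma tau_tgtL Y a (g g' : hom Y Z) f :
  tau_tgt (a *: g + g') f = a * tau_tgt g f + tau_tgt g' f.
Proof. by rewrite /= comp_linl linearP. Qed.

Lemma repr_src Y (phi : {linear hom Y Z -> k^o}) : nondeg_tgt tau Y ->
  exists f, forall g, phi g = tau (g \oc f).
Proof.
move=> nd; apply: (pairing_repr (@tau_srcL Y) nd); exact: hom_fd.
Qed.

Lemma repr_tgt Y (phi : {linear hom X Y -> k^o}) : nondeg_src tau Y ->
  exists g, forall f, phi f = tau (g \oc f).
Proof.
move=> nd; apply: (pairing_repr (@tau_tgtL Y) nd); exact: hom_fd.
Qed.

Lemma nondeg_isom Y Y' : isom Y Y' -> nondeg Y -> nondeg Y'.
Proof.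
move=> [a [b [ba ab]]] [src tgt]; split=> f f0.
  rewrite -[f]comp1m -ab -compA [b \oc f]src ?comp0r // => g.
  by rewrite compA f0.
rewrite -[f]compm1 -ab compA [f \oc a]tgt ?comp0l // => g.
by rewrite -compA f0.
Qed.

(* The five lemma for a triangle A -> B -> C, with the exact sequences Hom(X,-) and
   Hom(-,Z) adjoint to each other under tau. *)
Lemma nondeg_cone A B C : triangle A B C ->
  nondeg A -> nondeg B -> nondeg (S A) -> nondeg (S B) -> nondeg C.
Proof.
move=> [f [g [h fgh]]] [_ tgtA] [srcB tgtB] [srcSA tgtSA] [srcSB _].
split=> x x0.
  have hx : h \oc x = 0 by apply: srcSA => v; rewrite compA x0.
  have /dist_rot gh := fgh; have [x2 x2E] := dist_cov gh hx.
  (* The form tau(- x2) vanishes on maps killed by [f], so it factors through Hom(A, Z) and is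
     represented by some x1 : X -> A. Then x2 = f x1, whence x = g x2 = 0. *)
  have [v|psi psiE] := @factor_form k _ _ (prec Z f) (tau_src x2)
      (hom_fd D_fin _ _) (hom_fd D_fin _ _).
    by move=> /(dist_con fgh) [v' ->]; rewrite /= -compA -x2E x0.
  have [x1 x1E] := repr_src psi tgtA.
  have x2E' : x2 = f \oc x1.
    apply/eqP; rewrite -subr_eq0; apply/eqP/srcB => v.
    by have := psiE v; rewrite x1E /= compDr compNr linearB /= compA => ->; rewrite subrr.
  by rewrite x2E x2E' compA (dist_comp0 fgh) comp0l.
have xg : x \oc g = 0 by apply: tgtB => v; rewrite -compA x0.
have /dist_rot gh := fgh; have [x4 x4E] := dist_con gh xg.
have [v|psi psiE] := @factor_form k _ _ (postc X f[1]) (tau_tgt x4)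
    (hom_fd D_fin _ _) (hom_fd D_fin _ _).
  move=> /= fv; have fv' : - f[1] \oc v = 0 by rewrite compNl fv oppr0.
  by have [v' ->] := dist_cov (dist_rot2 fgh) fv'; rewrite compA -x4E x0.
have [x5 x5E] := repr_tgt psi srcSB.
have x4E' : x4 = x5 \oc f[1].
  apply/eqP; rewrite -subr_eq0; apply/eqP/tgtSA => v.
  have := psiE v; rewrite x5E /= compDl compNl linearB /= -compA => ->.
  by rewrite subrr.
have := dist_comp0 (dist_rot2 fgh); rewrite compNl => /eqP.
by rewrite oppr_eq0 => /eqP fh; rewrite x4E x4E' -compA fh comp0r.
Qed.

End Nondeg.

Lemma zero_obj_shiftn Z p : zero_obj Z -> zero_obj (shiftn Z p).
Proof.
move=> [Z0 _]; apply/zero_objP; have := lbij_shiftn Z Z 0 0 p.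
by rewrite !add0r => /lbij_all0; apply; apply: Z0.
Qed.

Lemma full_ind n (E : 'I_n -> D) (P : D -> Prop) : full_collection E ->
  triangulated_subcat P -> (forall i, P (E i)) -> forall X, P X.
Proof.
move=> Efull PT PE X; suff : (setT X : Prop) -> P X by apply.
by rewrite -Efull; apply; split=> // _ [i _ <-].
Qed.

Definition serre_pair X Z (tau : {linear hom X Z -> k^o}) :=
  forall Y, nondeg tau Y.

(** All translates are carried through the induction because the five lemma for a cone also uses the
    translates of its first two vertices. *)
Lemma serre_pair_full n (E : 'I_n -> D) X Z (tau : {linear hom X Z -> k^o}) :
  full_collection E -> (forall i q, nondeg tau (shiftn (E i) q)) ->
  serre_pair tau.
Proof.
move=> Efull tauE; suff nd Y : forall p, nondeg tau (shiftn Y p).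
  by move=> Y; apply: (nd Y 0).
apply: (@full_ind n E (fun Y => forall p, nondeg tau (shiftn Y p)) Efull) Y => //.
split.
- by move=> Y Y' YY' nd p; apply: nondeg_isom (isom_shiftn p YY') (nd p).
- move=> Y Y0 p; have [Y1 Y2] := zero_obj_shiftn p Y0.
  by split=> f _; [apply: Y2|apply: Y1].
- by move=> Y nd p; apply: nondeg_isom (isom_sym (shiftn_shift _ _)) (nd _).
- by move=> Y nd p; apply: nondeg_isom (isom_sym (shiftn_unshift _ _)) (nd _).
- move=> A B C f g h fgh ndA ndB p.
  have tri : triangle A B C by exists f, g, h.
  apply: nondeg_cone (triangle_shiftn p tri) (ndA p) (ndB p) _ _.
    exact: nondeg_isom (isom_sym (shiftnS _ _)) (ndA _).
  exact: nondeg_isom (isom_sym (shiftnS _ _)) (ndB _).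
Qed.

Section Existence.
Variables (n : nat) (E : 'I_n -> D).
Hypothesis E_full_exc : full_exc E.

Lemma serre_pair_ex X : exists Z (tau : {linear hom X Z -> k^o}), serre_pair tau.
Proof.
have [Eexc Efull] := E_full_exc.
have [Z [tau tauE]] := @partner_ex k D n (fun m q => shiftn (E m) q)
  (tcat_additive D) (hom_fd D_fin) (fun m => fin_support_l D_fin (E m))
  (fun m X => fin_support D_fin X (E m)) (exc_triang Eexc) (exc_cone Eexc) X.
by exists Z, tau; apply: serre_pair_full Efull tauE.
Qed.

(** Passing to the opposite category reverses triangularity, whence the reindexing by [rev_ord], and
    replaces cones by cocones. *)
Lemma serre_pair_ex_l Z : exists X (tau : {linear hom X Z -> k^o}), serre_pair tau.
Proof.
have [Eexc Efull] := E_full_exc.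
have [|||||X [tau tauE]] := @partner_ex k (op_cat D) n
  (fun m q => shiftn (E (rev_ord m)) q) (op_additive (tcat_additive D)) _ _ _ _ _ Z.
- by move=> X Y; apply: (hom_fd D_fin).
- by move=> m X; apply: (fin_support D_fin).
- by move=> m X; apply: (fin_support_l D_fin).
- move=> l m q p ml; apply: (exc_triang Eexc).
  by rewrite /= ltn_sub2l // (leq_ltn_trans _ (ltn_ord l)).
- move=> m p X g g0; have [X' [j [jg jE jsurj]]] := exc_cocone Eexc g0.
  exists X', j; split=> // l q ml; apply: jsurj.
  by rewrite /= leq_sub2l.
exists X, tau; apply: serre_pair_full Efull _ => i q.
by have := tauE (rev_ord i) q; rewrite rev_ordK => -[].
Qed.

Lemma serre_pair_uniq X Z Z' (tau : {linear hom X Z -> k^o})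
    (tau' : {linear hom X Z' -> k^o}) :
  serre_pair tau -> serre_pair tau' -> isom Z Z'.
Proof.
move=> nd nd'; have [a aE] := repr_tgt tau (nd' Z).1.
have [b bE] := repr_tgt tau' (nd Z').1; exists a, b; split; apply/eqP.
  rewrite -subr_eq0; apply/eqP/(nd Z).2 => f.
  by rewrite compDl compNl linearB /= comp1m -compA -bE -aE subrr.
rewrite -subr_eq0; apply/eqP/(nd' Z').2 => f.
by rewrite compDl compNl linearB /= comp1m -compA -aE -bE subrr.
Qed.

Definition serre_ob X : D := sval (cid (serre_pair_ex X)).

Definition serre_tr X : {linear hom X (serre_ob X) -> k^o} :=
  sval (cid (svalP (cid (serre_pair_ex X)))).

Lemma serre_trP X : serre_pair (serre_tr X).
Proof. exact: (svalP (cid (svalP (cid (serre_pair_ex X))))). Qed.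

(** On morphisms S is forced by the trace identity tau_X(f a) = tau_X'(S(a) f). Uniqueness of the
    solution then yields linearity and functoriality. *)
Lemma serre_map_ex X X' (a : hom X X') :
  exists b : hom (serre_ob X) (serre_ob X'),
  forall f, serre_tr X (f \oc a) = serre_tr X' (b \oc f).
Proof. exact: (repr_tgt (tau_src (serre_tr X) a) (serre_trP X' _).1). Qed.

Definition serre_map X X' (a : hom X X') := sval (cid (serre_map_ex a)).

Lemma serre_mapP X X' (a : hom X X') f :
  serre_tr X (f \oc a) = serre_tr X' (serre_map a \oc f).
Proof. exact: (svalP (cid (serre_map_ex a))). Qed.

Lemma serre_map_uniq X X' (a : hom X X') b :
  (forall f, serre_tr X (f \oc a) = serre_tr X' (b \oc f)) -> serre_map a = b.
Proof.
move=> bE; apply/eqP; rewrite -subr_eq0; apply/eqP/(serre_trP X' _).2 => f.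
by rewrite compDl compNl linearB /= -serre_mapP bE subrr.
Qed.

Lemma serre_map_linear X X' : linear (@serre_map X X').
Proof.
move=> c a a'; apply: serre_map_uniq => f.
by rewrite comp_linr lformP comp_linl lformP (serre_mapP a) (serre_mapP a').
Qed.

Lemma serre_map1 X : serre_map (idm X) = idm (serre_ob X).
Proof. by apply: serre_map_uniq => f; rewrite compm1 comp1m. Qed.

Lemma serre_mapM X Y Z (g : hom Y Z) (f : hom X Y) :
  serre_map (g \oc f) = serre_map g \oc serre_map f.
Proof.
by apply: serre_map_uniq => h; rewrite compA (serre_mapP f) compA (serre_mapP g) compA.
Qed.

Definition serre_fun : lfunctor D D :=
  @LFunctor k D D serre_ob (fun X Y => lin (@serre_map_linear X Y))
    serre_map1 serre_mapM.

Lemma inj_surj_bij (T U : Type) (f : T -> U) :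
  injective f -> (forall y, exists x, f x = y) -> bijective f.
Proof.
move=> fI fS; pose g y := sval (cid (fS y)).
have gK : cancel g f by move=> y; apply: (svalP (cid (fS y))).
by exists g => // x; apply: fI; rewrite gK.
Qed.

Lemma serre_functor_ex : exists F : lfunctor D D, serre_functor F.
Proof.
exists serre_fun; split; first split.
- move=> X Y; apply: inj_surj_bij => [a a' /= aa'|b].
    apply/eqP; rewrite -subr_eq0; apply/eqP/(serre_trP X _).1 => g.
    by rewrite compDr compNr linearB /= (serre_mapP a) (serre_mapP a') aa' subrr.
  have [a aE] := repr_src (tau_tgt (serre_tr Y) b) (serre_trP X _).2.
  by exists a; apply: serre_map_uniq => f; rewrite -aE.
- move=> Z; have [X [tau tauP]] := serre_pair_ex_l Z; exists X.
  exact: serre_pair_uniq (serre_trP X) tauP.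
exists (fun X Y f => tau_src (serre_tr X) f); split.
- by move=> X Y a f f' g; apply: tau_srcL.
- move=> X Y; apply: inj_surj_bij => [f f' ff'|phi].
    apply/eqP; rewrite -subr_eq0; apply/eqP/(serre_trP X _).1 => g.
    rewrite compDr compNr linearB /=; apply/eqP; rewrite subr_eq0; apply/eqP.
    exact: (congr1 (fun phi : {linear _ -> _} => phi g) ff').
  have [f fE] := repr_src phi (serre_trP X _).2; exists f.
  by apply: lin_inj => g; rewrite fE.
- by move=> X X' Y Y' a b f g; rewrite /= compA (serre_mapP a) !compA.
Qed.

End Existence.

End SerrePairs.

(** * The Euler form on the Grothendieck group *)

Local Open Scope quotient_scope.

(* For a long exact sequence a_i -> b_i -> c_i -> a_(i+1) (or its reverse), rho,
   gam and eta are the ranks of the successive maps. *)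
Lemma telescope_exact (a b c rho gam eta : nat -> nat) M :
  (forall i, b i = rho i + gam i)%N -> (forall i, c i = gam i + eta i)%N ->
  (forall i, a i.+1 = eta i + rho i.+1)%N ->
  a 0%N = 0%N -> b 0%N = 0%N -> a M = 0%N ->
  \sum_(i < M) (-1) ^+ i * ((a i)%:Z - (b i)%:Z + (c i)%:Z) = 0.
Proof.
move=> bE cE aE a0 b0.
have rho0 : rho 0%N = 0%N by apply/eqP; move/eqP: b0; rewrite bE addn_eq0 => /andP[].
have S m : \sum_(i < m.+1) (-1) ^+ i * ((a i)%:Z - (b i)%:Z + (c i)%:Z)
    = (-1) ^+ m * (eta m)%:Z.
  elim: m => [|m IHm].
    by rewrite big_ord1 a0 bE cE rho0 add0n sub0r PoszD addrA addNr add0r.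
  rewrite big_ord_recr /= IHm aE bE cE !PoszD exprS !mulN1r.
  by ring.
case: M => [|M aM]; first by rewrite big_ord0.
have : eta M = 0%N by apply/eqP; move/eqP: aM; rewrite aE addn_eq0 => /andP[].
by rewrite S => ->; rewrite mulr0.
Qed.

Lemma sign_subz (i N : nat) : (-1) ^ (i%:Z - N%:Z) = (-1) ^+ (N + i) :> int.
Proof.
have [iN|/ltnW iN] := leqP N i; rewrite -(subnKC iN); set d := (_ - _)%N.
  have -> : (N + d)%:Z - N%:Z = d%:Z by lia.
  by rewrite -exprnP addnA exprD [(-1) ^+ (N + N)]exprD -expr2 sqrr_sign mul1r.
have -> : i%:Z - (i + d)%:Z = - d%:Z by lia.
rewrite -exprnN invr_sign -addnA addnCA exprD [(-1) ^+ (i + i)]exprD.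
by rewrite -expr2 sqrr_sign mulr1.
Qed.

Section Euler.
Variables (k : fieldType) (D : tricat k).
Hypothesis D_fin : finite_type D.
Implicit Types W X Y Z A B : D.
Local Notation "f [1]" := (fmap (@shift k D) f) (at level 2, format "f [1]").
Local Notation S := (@shift k D).

Definition vanishes_from X Y N :=
  forall p : int, (N <= `|p|)%N -> forall f : hom X (shiftn Y p), f = 0.

Lemma vanishes_ex X Y : exists N0, forall N, (N0 <= N)%N -> vanishes_from X Y N.
Proof.
have [s sP] := fin_support D_fin X Y.
exists (\max_(q <- s) `|q|%N).+1 => N sN p Np; apply: sP.
apply/negP => ps; have := leq_trans sN Np.
by rewrite ltnNge (leq_bigmax_seq _ ps).
Qed.

(** The window -N <= p < N is indexed by i = p + N. The terms at p = -N and p = N vanish, which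
    supplies the end conditions of [telescope_exact]. *)
Lemma eulerE X Y N : vanishes_from X Y N ->
  euler X Y = \sum_(i < 2 * N) (-1) ^+ (N + i) *
    (dimk (hom X (shiftn Y (i%:Z - N%:Z))))%:Z.
Proof.
move=> XY0; pose h (i : nat) : int := i%:Z - N%:Z.
have h_inj : injective h by move=> i j /addIr [].
rewrite /euler (fsbigE [seq h i | i <- iota 0 (2 * N)]) //; last 2 first.
- by rewrite map_inj_uniq ?iota_uniq.
- move=> p _ ps; rewrite dimk0 ?mulr0 //; apply: XY0.
  apply: contraNT ps; rewrite -ltnNge => pN; apply/mapP.
  exists (absz (p + N%:Z)); last by rewrite /h; lia.
  by rewrite mem_iota; lia.
rewrite (eq_bigl xpredT); last by move=> p; rewrite in_setT.
rewrite big_map -[X in iota 0 X]subn0 -/(index_iota 0 _) big_mkord.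
by apply: eq_bigr => i _; rewrite sign_subz.
Qed.

Lemma eulerE_r X Y N : vanishes_from X Y N ->
  euler X Y = (-1) ^+ N *
    \sum_(i < 2 * N) (-1) ^+ i * (dimk (hom (iter N S X) (iter i S Y)))%:Z.
Proof.
move=> /eulerE ->; rewrite mulr_sumr; apply: eq_bigr => i _.
by rewrite exprD mulrA (lbij_dimk (lbij_iter_shift _ _ _ _)).
Qed.

(** Here the varying translation sits on the source, so the window is read backwards, p = N - i. *)
Lemma eulerE_l X Y N : vanishes_from X Y N ->
  euler X Y = (-1) ^+ N *
    \sum_(i < 2 * N) (-1) ^+ i * (dimk (hom (iter i S X) (iter N S Y)))%:Z.
Proof.
move=> XY0; pose h (i : nat) : int := N%:Z - i%:Z.
have h_inj : injective h by move=> i j /addrI/oppr_inj [].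
rewrite /euler (fsbigE [seq h i | i <- iota 0 (2 * N)]) //; last 2 first.
- by rewrite map_inj_uniq ?iota_uniq.
- move=> p _ ps; rewrite dimk0 ?mulr0 //; apply: XY0.
  apply: contraNT ps; rewrite -ltnNge => pN; apply/mapP.
  exists (absz (N%:Z - p)); last by rewrite /h; lia.
  by rewrite mem_iota; lia.
rewrite (eq_bigl xpredT); last by move=> p; rewrite in_setT.
rewrite big_map -[X in iota 0 X]subn0 -/(index_iota 0 _) big_mkord mulr_sumr.
apply: eq_bigr => i _; rewrite sign_subz addnC exprD -mulrA.
by rewrite (lbij_dimk (lbij_iter_shift _ _ _ _)).
Qed.

(* The signs are those of three rotations of a triangle. *)
Fixpoint iter_map X Y (f : hom X Y) i : hom (iter i S X) (iter i S Y) :=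
  if i is j.+1 then - (iter_map f j)[1] else f.

Fixpoint iter_map3 Z X (h : hom Z (S X)) i : hom (iter i S Z) (S (iter i S X)) :=
  if i is j.+1 then - (iter_map3 h j)[1] else h.

Lemma dist_iter X Y Z (f : hom X Y) (g : hom Y Z) (h : hom Z (S X)) i :
  dist f g h -> dist (iter_map f i) (iter_map g i) (iter_map3 h i).
Proof. by move=> fgh; elim: i => //= i; apply: dist_rot3. Qed.

Lemma dim_iter0 X Y N (i j : nat) : vanishes_from X Y N ->
  (N <= absz (j%:Z - i%:Z))%N ->
  dimk (hom (iter i S X) (iter j S Y)) = 0%N.
Proof.
by move=> XY0 Nij; rewrite -(lbij_dimk (lbij_iter_shift _ _ _ _)) dimk0 //; apply: XY0.
Qed.

Lemma euler_dist_r W X Y Z (f : hom X Y) (g : hom Y Z) (h : hom Z (S X)) :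
  dist f g h -> euler W X - euler W Y + euler W Z = 0.
Proof.
move=> fgh; have [N1 X0] := vanishes_ex W X; have [N2 Y0] := vanishes_ex W Y.
have [N3 Z0] := vanishes_ex W Z; pose N := (N1 + N2 + N3)%N.
have {}X0 : vanishes_from W X N by apply: X0; rewrite /N; lia.
have {}Y0 : vanishes_from W Y N by apply: Y0; rewrite /N; lia.
have {}Z0 : vanishes_from W Z N by apply: Z0; rewrite /N; lia.
rewrite (eulerE_r X0) (eulerE_r Y0) (eulerE_r Z0) -mulrBr -mulrDr.
rewrite -sumrB -big_split /= -[RHS](mulr0 ((-1) ^+ N)); congr (_ * _).
under eq_bigr => i _ do rewrite -mulrBr -mulrDr.
pose W' := iter N S W; have fd := hom_fd D_fin.
have fghi i := dist_iter i fgh.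
apply: (@telescope_exact (fun i => dimk (hom W' (iter i S X)))
  (fun i => dimk (hom W' (iter i S Y))) (fun i => dimk (hom W' (iter i S Z)))
  (fun i => rk (postc W' (iter_map f i))) (fun i => rk (postc W' (iter_map g i)))
  (fun i => rk (postc W' (iter_map3 h i)))) => [i|i|i|||].
- apply: exact_dim => // [u|v]; last exact: dist_cov.
  by rewrite /= compA (dist_comp0 (fghi i)) comp0l.
- have /dist_rot ghi := fghi i.
  apply: exact_dim => // [u|v]; last exact: (dist_cov ghi).
  by rewrite /= compA (dist_comp0 ghi) comp0l.
- have hfi := dist_rot2 (fghi i).
  apply: exact_dim => // [u|v]; last exact: (dist_cov hfi).
  by rewrite /= compA (dist_comp0 hfi) comp0l.
- by apply: (dim_iter0 X0); lia.
- by apply: (dim_iter0 Y0); lia.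
- by apply: (dim_iter0 X0); lia.
Qed.

Lemma euler_dist_l W X Y Z (f : hom X Y) (g : hom Y Z) (h : hom Z (S X)) :
  dist f g h -> euler X W - euler Y W + euler Z W = 0.
Proof.
move=> fgh; have [N1 X0] := vanishes_ex X W; have [N2 Y0] := vanishes_ex Y W.
have [N3 Z0] := vanishes_ex Z W; pose N := (N1 + N2 + N3)%N.
have {}X0 : vanishes_from X W N by apply: X0; rewrite /N; lia.
have {}Y0 : vanishes_from Y W N by apply: Y0; rewrite /N; lia.
have {}Z0 : vanishes_from Z W N by apply: Z0; rewrite /N; lia.
rewrite (eulerE_l X0) (eulerE_l Y0) (eulerE_l Z0) -mulrBr -mulrDr.
rewrite -sumrB -big_split /= -[RHS](mulr0 ((-1) ^+ N)); congr (_ * _).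
under eq_bigr => i _ do rewrite -mulrBr -mulrDr.
pose W' := iter N S W; have fd := hom_fd D_fin.
have fghi i := dist_iter i fgh.
apply: (@telescope_exact (fun i => dimk (hom (iter i S X) W'))
  (fun i => dimk (hom (iter i S Y) W')) (fun i => dimk (hom (iter i S Z) W'))
  (fun i => rk (prec W' (iter_map f i))) (fun i => rk (prec W' (iter_map g i)))
  (fun i => rk (prec W' (iter_map3 h i)))) => [i|i|i|||].
(* Contravariance reverses the order of the two maps, hence of their ranks. *)
- rewrite addnC; apply: exact_dim => // [u|v]; last exact: dist_con.
  by rewrite /= -compA (dist_comp0 (fghi i)) comp0r.
- have /dist_rot ghi := fghi i.
  rewrite addnC; apply: exact_dim => // [u|v]; last exact: (dist_con ghi).
  by rewrite /= -compA (dist_comp0 ghi) comp0r.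
- have hfi := dist_rot2 (fghi i).
  rewrite addnC; apply: exact_dim => // [u|v]; last exact: (dist_con hfi).
  by rewrite /= -compA (dist_comp0 hfi) comp0r.
- by apply: (dim_iter0 X0); lia.
- by apply: (dim_iter0 Y0); lia.
- by apply: (dim_iter0 X0); lia.
Qed.

End Euler.

Section GrothendieckGroup.
Variables (k : fieldType) (D : tricat k).
Implicit Types W X Y Z A B : D.
Local Notation S := (@shift k D).
Local Notation cl := (@K0_class k D).

Lemma zmod_closed_mulz (K : zmodType) (P : K -> Prop) :
  P 0 -> (forall x y, P x -> P y -> P (x - y)) ->
  (forall x y, P x -> P y -> P (x + y)) /\ forall x m, P x -> P (x *~ m).
Proof.
move=> P0 PB; have PN x : P x -> P (- x) by move=> Px; rewrite -sub0r; apply: PB.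
have PD x y : P x -> P y -> P (x + y).
  by move=> Px Py; rewrite -[y]opprK; apply: PB => //; apply: PN.
split=> // x m Px; have Pn n : P (x *+ n).
  by elim: n => // n IHn; rewrite mulrS; apply: PD.
by case: m => n; [exact: Pn|rewrite NegzE mulrNz; apply: PN; apply: Pn].
Qed.

Lemma K0_ind (P : K0 D -> Prop) : P 0 -> (forall x y, P x -> P y -> P (x - y)) ->
  (forall X, P (cl X)) -> forall x, P x.
Proof.
move=> P0 PB Pcl x; have [PD PM] := zmod_closed_mulz P0 PB.
pose pi (z : free_K0 D) : K0 D := \pi_(Quotient.quot (@K0_null k D : zmodClosed _)) z.
have pi0 : pi 0 = 0 by apply: raddf0.
have piD y z : pi (y + z) = pi y + pi z by apply: raddfD.
have piM y m : pi (y *~ m) = pi y *~ m by apply: raddfMz.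
rewrite -[x]reprK -/(pi (repr x)) -[repr x]freeg_sumE.
elim: (dom _) => [|X s IHs]; first by rewrite big_nil pi0.
rewrite big_cons piD; apply: PD => //.
have -> : << coeff X (repr x) *g X >> = (obj_gen X) *~ coeff X (repr x).
  by apply/eqP/freeg_eqP => Y; rewrite raddfMz /= !coeffU mul1r -mulrzl intz.
by rewrite piM; apply: PM; apply: Pcl.
Qed.

Lemma K0_lift (phi : D -> int) :
  (forall X Y Z (f : hom X Y) (g : hom Y Z) (h : hom Z (S X)),
     dist f g h -> phi X - phi Y + phi Z = 0) ->
  exists psi : K0 D -> int,
    (forall x y, psi (x + y) = psi x + psi y) /\ forall X, psi (cl X) = phi X.
Proof.
move=> phi0; pose L (z : free_K0 D) : int := fglift (phi : {classic D} -> int^o) z.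
have LB : {morph L : x y / x - y}.
  exact: (lift_is_additive (phi : {classic D} -> int^o)).
have LU X : L (obj_gen X) = phi X by rewrite /L liftU scale1r.
have L0 : L 0 = 0 by rewrite -(subrr 0) LB subrr.
have LD x y : L (x + y) = L x + L y.
  by rewrite -{1}[y]opprK LB -(sub0r y) LB L0 sub0r opprK.
have Lnull z : @K0_null k D z -> L z = 0.
  move=> /asboolP /(_ (fun z => L z = 0)); apply=> // [x y x0 y0|x].
    by rewrite LB x0 y0 subrr.
  by move=> [X [Y [Z [f [g [h [fgh ->]]]]]]]; rewrite LD LB !LU; apply: phi0 fgh.
pose pi (z : free_K0 D) : K0 D := \pi_(Quotient.quot (@K0_null k D : zmodClosed _)) z.
have Lpi z : L (repr (pi z)) = L z.
  apply/eqP; rewrite -subr_eq0 -LB; apply/eqP/Lnull.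
  have /eqP : pi (repr (pi z)) = pi z by apply: reprK.
  by rewrite -Quotient.idealrBE.
exists (fun x => L (repr x)); split=> [x y|X]; last first.
  by rewrite -LU; apply: Lpi.
have -> : x + y = pi (repr x + repr y).
  by rewrite -[x in LHS]reprK -[y in LHS]reprK /pi raddfD.
by rewrite Lpi LD.
Qed.

Lemma K0_dist X Y Z (f : hom X Y) (g : hom Y Z) (h : hom Z (S X)) :
  dist f g h -> cl Y = cl X + cl Z.
Proof.
move=> fgh; pose pi (z : free_K0 D) : K0 D :=
  \pi_(Quotient.quot (@K0_null k D : zmodClosed _)) z.
have : pi (obj_gen X + obj_gen Z) = pi (obj_gen Y).
  apply/eqP; rewrite -Quotient.idealrBE; apply/asboolP => P P0 PB; apply.
  by exists X, Y, Z, f, g, h; split=> //; rewrite addrAC.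
by rewrite /pi raddfD.
Qed.

Lemma K0_zero Z : zero_obj Z -> cl Z = 0.
Proof.
move=> Z0; have := K0_dist (dist_id Z Z0).
by move=> /eqP; rewrite addrC -subr_eq subrr => /eqP <-.
Qed.

Lemma K0_shift X : cl (S X) = - cl X.
Proof.
have [Z Z0] := (tcat_additive D).1; have /dist_rot := dist_id X Z0.
by move=> /K0_dist; rewrite (K0_zero Z0) => /esym/eqP; rewrite addr_eq0 => /eqP ->;
  rewrite opprK.
Qed.

Lemma K0_isom X Y : isom X Y -> cl X = cl Y.
Proof.
move=> [f f_iso]; have [Z Z0] := (tcat_additive D).1.
have fd : dist f (0 : hom Y Z) (0 : hom Z (S X)).
  have [g [gf fg]] := f_iso.
  apply: (dist_iso (a := idm X) (b := f) (c := idm Z)) (dist_id X Z0) => //;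
    try exact: is_iso_id.
  - by rewrite comp0r comp0l.
  - by rewrite comp0r comp0l.
by rewrite (K0_dist fd) (K0_zero Z0) addr0.
Qed.

Lemma K0_unshift X : cl (unshift X) = - cl X.
Proof. by rewrite -(K0_isom (unshiftP X)) K0_shift opprK. Qed.

Lemma K0_shiftn X p : cl (shiftn X p) = cl X *~ ((-1) ^ p).
Proof.
have iter_sign (F : D -> D) n : (forall Y, cl (F Y) = - cl Y) ->
    cl (iter n F X) = cl X *~ ((-1) ^+ n).
  move=> FN; elim: n => [|n IHn]; first by rewrite expr0 mulr1z.
  by rewrite iterS FN IHn exprS mulN1r mulrNz.
case: p => n; first exact: iter_sign K0_shift.
apply: etrans (iter_sign _ n.+1 K0_unshift) _.
by rewrite NegzE -exprnN invr_sign.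
Qed.

(** The cone of the inclusion [i] is Y: since i[1] is a split monomorphism the connecting map [h]
    vanishes, and the factorization of [q] through the cone is inverse to g j. *)
Lemma dist_biproduct X Y T (i : hom X T) (j : hom Y T) (p : hom T X) (q : hom T Y) :
  p \oc i = idm X -> q \oc j = idm Y -> q \oc i = 0 -> p \oc j = 0 ->
  i \oc p + j \oc q = idm T -> cl T = cl X + cl Y.
Proof.
move=> pi qj qi pj ij; have [Z [g [h igh]]] := dist_cone i.
rewrite (K0_dist igh); congr (_ + _); apply: K0_isom.
have [q' qE] := dist_con igh qi; exists q', (g \oc j); split.
  apply/eqP; rewrite -subr_eq0; apply/eqP.
  set e := _ - _; have eg : e \oc g = 0.
    rewrite /e compDl compNl comp1m -!compA -qE.
    have {2}-> : g = g \oc (i \oc p + j \oc q) by rewrite ij compm1.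
    by rewrite compDr (compA g i) (dist_comp0 igh) comp0l add0r subrr.
  have /dist_rot gh := igh; have [x ->] := dist_con gh eg.
  suff -> : h = 0 by rewrite comp0r.
  have := dist_comp0 (dist_rot2 igh); rewrite compNl => /eqP.
  rewrite oppr_eq0 => /eqP ih.
  by rewrite -[h]comp1m -fmap1 -pi fmapM -compA ih comp0r.
by rewrite compA -qE.
Qed.

Section EulerForm.
Hypothesis D_fin : finite_type D.

(** The Euler form is lifted one variable at a time. In the second lifting, additivity on triangles
    against an arbitrary class y is reduced by [K0_ind] to the case of objects. *)
Lemma euler_form_ex : exists chi : K0 D -> K0 D -> int, euler_form chi.
Proof.
have r_ex X := K0_lift (fun _ _ _ _ _ _ => @euler_dist_r _ _ D_fin X _ _ _ _ _ _).
pose r X := sval (cid (r_ex X)).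
have rD X x y : r X (x + y) = r X x + r X y by apply: (svalP (cid (r_ex X))).1.
have rE X Y : r X (cl Y) = euler X Y by apply: (svalP (cid (r_ex X))).2.
have r0 X : r X 0 = 0 by apply: (addrI (r X 0)); rewrite -rD !addr0.
have rB X x y : r X (x - y) = r X x - r X y.
  by apply/eqP; rewrite eq_sym subr_eq -rD subrK.
have l_ex y : exists psi : K0 D -> int,
    (forall x x', psi (x + x') = psi x + psi x') /\ forall X, psi (cl X) = r X y.
  apply: K0_lift => X Y Z f g h fgh; elim/K0_ind: y => [|x y x0 y0|W].
  - by rewrite !r0 subrr.
  - rewrite !rB -[RHS](subrr 0) -{1}x0 -y0; ring.
  - by rewrite !rE; apply: euler_dist_l fgh.
pose chi x y := sval (cid (l_ex y)) x.
have chiD x x' y : chi (x + x') y = chi x y + chi x' y.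
  exact: (svalP (cid (l_ex y))).1.
have chiE X y : chi (cl X) y = r X y by apply: (svalP (cid (l_ex y))).2.
have chi0 y : chi 0 y = 0 by apply: (addrI (chi 0 y)); rewrite -chiD !addr0.
have chiB x x' y : chi (x - x') y = chi x y - chi x' y.
  by apply/eqP; rewrite eq_sym subr_eq -chiD subrK.
exists chi; split; last by move=> X Y; rewrite chiE rE.
split=> // x y z; elim/K0_ind: x => [|x x' xE x'E|X].
- by rewrite !chi0 addr0.
- by rewrite !chiB xE x'E; ring.
- by rewrite !chiE rD.
Qed.

End EulerForm.

End GrothendieckGroup.

(** * Root systems of exceptional bases *)

Local Open Scope classical_set_scope.

(** The integral transition matrices between two bases multiply to the identity, which bounds each
    size by the other. *)
Lemma zbasis_size (K : zmodType) m n (b : 'I_m -> K) (b' : 'I_n -> K) :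
  zbasis b -> zbasis b' -> m = n.
Proof.
have le p q (c : 'I_p -> K) (c' : 'I_q -> K) : zbasis c -> zbasis c' -> (p <= q)%N.
  move=> cB c'B; have [f fE] := choice (fun i => ex_intro _ _ (svalP (cid (c'B (c i))))).
  have [g gE] := choice (fun i => ex_intro _ _ (svalP (cid (cB (c' i))))).
  pose A : 'M[int]_(p, q) := \matrix_(i, j) f i j.
  pose B : 'M[int]_(q, p) := \matrix_(i, j) g i j.
  apply: (@mulmx1_min _ _ _ A B); apply/matrixP => i j; rewrite !mxE.
  have [a [aE aU]] := cB (c i).
  have /(_ [ffun j => (A *m B) i j]) aAB := aU.
  have /(_ [ffun j => (i == j)%:R]) a1 := aU.
  have : [ffun j => (A *m B) i j] = [ffun j => (i == j)%:R] :> {ffun 'I_p -> int}.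
    rewrite -aAB; [rewrite -a1 //|].
      rewrite (bigD1 i) //= ffunE eqxx big1 ?addr0 // => l li.
      by rewrite ffunE eq_sym (negPf li) mulr0z.
    rewrite (fE i).1.
    under eq_bigr => l _ do rewrite (gE l).1 mulrz_suml.
    rewrite exchange_big /=; apply: eq_bigr => l _; rewrite ffunE mxE.
    rewrite mulrz_sumr; apply: eq_bigr => s _.
    by rewrite !mxE -mulrzA mulrC.
  by move/ffunP/(_ j); rewrite !ffunE mxE.
move=> bB b'B; apply/eqP; rewrite eqn_leq (le _ _ _ _ bB b'B).
exact: le b'B bB.
Qed.

Section ExceptionalBasis.
Variables (K : zmodType) (chi : K -> K -> int).
Hypothesis chiL : bilinear_form chi.
Local Notation I := (fun x y => chi x y + chi y x).

Lemma chiDl x y z : chi (x + y) z = chi x z + chi y z. Proof. exact: chiL.1. Qed.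
Lemma chiDr x y z : chi x (y + z) = chi x y + chi x z. Proof. exact: chiL.2. Qed.
Lemma chi0l x : chi 0 x = 0.
Proof. by apply: (addrI (chi 0 x)); rewrite -chiDl !addr0. Qed.
Lemma chi0r x : chi x 0 = 0.
Proof. by apply: (addrI (chi x 0)); rewrite -chiDr !addr0. Qed.
Lemma chiNl x y : chi (- x) y = - chi x y.
Proof. by apply/eqP; rewrite -addr_eq0 -chiDl addNr chi0l. Qed.
Lemma chiNr x y : chi x (- y) = - chi x y.
Proof. by apply/eqP; rewrite -addr_eq0 -chiDr addNr chi0r. Qed.
Lemma chiMl x y m : chi (x *~ m) y = chi x y * m.
Proof.
have Mn n : chi (x *+ n) y = chi x y * n%:Z.
  elim: n => [|n IHn]; first by rewrite mulr0n chi0l mulr0.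
  by rewrite mulrS chiDl IHn intS mulrDr mulr1.
by case: m => n; [exact: Mn|rewrite NegzE mulrNz chiNl [chi _ _]Mn mulrN].
Qed.
Lemma chiMr x y m : chi x (y *~ m) = chi x y * m.
Proof.
have Mn n : chi x (y *+ n) = chi x y * n%:Z.
  elim: n => [|n IHn]; first by rewrite mulr0n chi0r mulr0.
  by rewrite mulrS chiDr IHn intS mulrDr mulr1.
by case: m => n; [exact: Mn|rewrite NegzE mulrNz chiNr [chi _ _]Mn mulrN].
Qed.
Definition chiE := (chiDl, chiDr, chiNl, chiNr, chiMl, chiMr).

Definition num_exc n (b : 'I_n -> K) :=
  (forall i, chi (b i) (b i) = 1) /\
  (forall i j : 'I_n, (j < i)%N -> chi (b i) (b j) = 0).

Lemma chi_sumr n (b : 'I_n -> K) x (a : 'I_n -> int) :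
  chi x (\sum_i b i *~ a i) = \sum_i chi x (b i) * a i.
Proof.
elim/big_rec2: _ => [|i y z _ <-]; first exact: chi0r.
by rewrite chiDr chiMr.
Qed.

Lemma chi_suml n (b : 'I_n -> K) x (a : 'I_n -> int) :
  chi (\sum_i b i *~ a i) x = \sum_i chi (b i) x * a i.
Proof.
elim/big_rec2: _ => [|i y z _ <-]; first exact: chi0l.
by rewrite chiDl chiMl.
Qed.

(** Back substitution from the last index down: pairing with b_j sees only a_j and the later
    coefficients, which already vanish. *)
Lemma num_exc_free n (b : 'I_n -> K) (a : 'I_n -> int) : num_exc b ->
  (forall j, chi (b j) (\sum_i b i *~ a i) = 0) -> forall i, a i = 0.
Proof.
move=> [b1 b0] ba0.
suff main m (i : 'I_n) : (n <= i + m)%N -> a i = 0.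
  by move=> i; apply: (main n); rewrite leq_addl.
elim: m i => [|m IHm] i im; first by move: im; rewrite addn0 leqNgt ltn_ord.
have := ba0 i; rewrite chi_sumr (bigD1 i) //= b1 mul1r big1 ?addr0 // => j ji.
have [lt_ji|le_ij] := ltnP j i; first by rewrite b0 ?mul0r.
rewrite (IHm j) ?mulr0 //; apply: leq_trans im _.
by rewrite addnS -addSn leq_add2r ltn_neqAle le_ij andbT eq_sym.
Qed.

Lemma num_exc_zbasis n (b : 'I_n -> K) : num_exc b ->
  (forall P : K -> Prop, P 0 -> (forall x y, P x -> P y -> P (x - y)) ->
     (forall i, P (b i)) -> forall x, P x) -> zbasis b.
Proof.
move=> bE gen x.
have [a aE] : exists a : {ffun 'I_n -> int}, x = \sum_i b i *~ a i.
  elim/gen: x => [|x y [a ->] [a' ->]|i].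
  - by exists [ffun=> 0]; rewrite big1 // => i _; rewrite ffunE mulr0z.
  - exists [ffun i => a i - a' i]; rewrite -sumrB; apply: eq_bigr => i _.
    by rewrite ffunE mulrzBr.
  - exists [ffun j => (j == i)%:R]; rewrite (bigD1 i) //= ffunE eqxx.
    by rewrite big1 ?addr0 // => j ji; rewrite ffunE (negPf ji) mulr0z.
exists a; split=> // a' a'E; apply/ffunP => i; apply/eqP; rewrite -subr_eq0.
apply/eqP; apply: (num_exc_free (a := fun i => a i - a' i) bE) => j.
under eq_bigr => l _ do rewrite mulrzBr.
by rewrite sumrB -aE -a'E subrr chi0r.
Qed.

Lemma chi_nondeg n (b : 'I_n -> K) z : num_exc b -> zbasis b ->
  (forall j, chi (b j) z = 0) -> z = 0.
Proof.
move=> bE bB; have [a [-> _]] := bB z => /(num_exc_free bE) a0.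
by rewrite big1 // => i _; rewrite a0 mulr0z.
Qed.

Lemma reflectionD a x y : reflection I a (x + y) = reflection I a x + reflection I a y.
Proof.
rewrite /reflection chiDl chiDr [X in _ *~ X]addrACA.
by rewrite [a *~ (_ + _ + (_ + _))]mulrzDr opprD addrACA.
Qed.

Lemma reflectionI a x y : I a a = 2 ->
  I (reflection I a x) (reflection I a y) = I x y.
Proof.
move=> aa; have {}aa : chi a a = 1 by lia.
by rewrite /reflection !chiE aa; ring.
Qed.

Lemma reflectionK a : I a a = 2 -> involutive (reflection I a).
Proof.
move=> aa x; have {}aa : chi a a = 1 by lia.
rewrite /reflection -addrA -opprD -mulrzDr !chiE aa.
by rewrite [X in _ *~ X](_ : _ = 0) ?mulr0z ?subr0 //; ring.
Qed.

Lemma reflection_aut a : I a a = 2 -> isometric_aut I (reflection I a).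
Proof.
move=> aa; split=> [|x y|x y]; first exact: inv_bij (reflectionK aa).
  exact: reflectionD.
exact: reflectionI.
Qed.

(** * Reflection groups and their orbits of roots *)

Section Orbit.
Variable B : set K.
Hypothesis B_norm : forall a, B a -> I a a = 2.

Lemma weyl_aut w : weyl I B w -> isometric_aut I w.
Proof.
elim=> {w} [|f [a Ba <-]|f g _ [fB fD fI] _ [gB gD gI]|f g _ [fB fD fI] fg gf].
- by split=> //; exists id.
- exact/reflection_aut/B_norm.
- split; first exact: bij_comp.
    by move=> x y; rewrite /= gD fD.
  by move=> x y; rewrite /= fI gI.
- split; first by exists f.
    by move=> x y; apply: (can_inj fg); rewrite fD !gf.
  by move=> x y; rewrite -fI !gf.
Qed.

Lemma orbit_norm a : weyl_orbit I B a -> I a a = 2.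
Proof. by move=> [w /weyl_aut [_ _ wI] [b Bb <-]]; rewrite wI B_norm. Qed.

Lemma orbit_sub : B `<=` weyl_orbit I B.
Proof. by move=> b Bb; exists id; [exact: GenId|exists b]. Qed.

Lemma weyl_orbit_stable w a : weyl I B w -> weyl_orbit I B a ->
  weyl_orbit I B (w a).
Proof.
by move=> Ww [v Wv [b Bb <-]]; exists (w \o v); [exact: GenComp|exists b].
Qed.

Lemma reflection_conj w w' a : isometric_aut I w -> cancel w w' -> cancel w' w ->
  reflection I (w a) = w \o reflection I a \o w'.
Proof.
move=> [_ wD wI] ww' w'w; apply/funext => x /=.
have w0 : w 0 = 0 by apply: (addrI (w 0)); rewrite -wD !addr0.
have wN y : w (- y) = - w y by apply/eqP; rewrite -addr_eq0 -wD addNr w0.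
have wM y m : w (y *~ m) = w y *~ m.
  have Mn n : w (y *+ n) = w y *+ n.
    by elim: n => [|n IHn]; rewrite ?mulr0n // !mulrS wD IHn.
  by case: m => n; [exact: Mn|rewrite NegzE !mulrNz wN [w _]Mn].
by rewrite /reflection wD wN wM -(wI (w' x) a) !w'w.
Qed.

(** Conjugation: r_(w b) = w r_b w^(-1). *)
Lemma orbit_reflection a : weyl_orbit I B a -> weyl I B (reflection I a).
Proof.
move=> [w Ww [b Bb <-]]; have [[w' ww' w'w] _ _] := weyl_aut Ww.
rewrite (reflection_conj _ (weyl_aut Ww) ww' w'w); apply: GenComp.
  by apply: GenComp => //; apply: GenIn; exists b.
exact: GenInv Ww ww' w'w.
Qed.

Lemma weyl_orbitE : weyl I (weyl_orbit I B) = weyl I B.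
Proof.
apply/seteqP; split=> w; elim=> {w} [|f [a]|f g _ Wf _|f g _ Wf].
- exact: GenId.
- by move=> /orbit_reflection Wa <-.
- exact: GenComp.
- exact: GenInv.
- exact: GenId.
- by move=> /orbit_sub Da <-; apply: GenIn; exists a.
- exact: GenComp.
- exact: GenInv.
Qed.

Lemma weyl_sub_orbit C : C `<=` weyl_orbit I B ->
  weyl_orbit I C `<=` weyl_orbit I B.
Proof.
move=> CB _ [w Ww [c Cc <-]]; apply: weyl_orbit_stable; last exact: CB.
rewrite -weyl_orbitE; elim: Ww => {w} [|f [a]|f g _ Wf _|f g _ Wf].
- exact: GenId.
- by move=> /CB Da <-; apply: GenIn; exists a.
- exact: GenComp.
- exact: GenInv.
Qed.

End Orbit.

Lemma num_exc_norm n (b : 'I_n -> K) a : num_exc b -> range b a -> I a a = 2.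
Proof. by move=> [b1 _] [i _ <-]; rewrite b1. Qed.

Lemma orbit_eq n (b : 'I_n -> K) m (b' : 'I_m -> K) : num_exc b -> num_exc b' ->
  (forall i, weyl_orbit I (range b) (b' i)) ->
  (forall i, weyl_orbit I (range b') (b i)) ->
  weyl_orbit I (range b') = weyl_orbit I (range b).
Proof.
move=> bE b'E bb' b'b; apply/seteqP; split.
  apply: weyl_sub_orbit => [a|_ [i _ <-]//]; exact: num_exc_norm bE.
apply: weyl_sub_orbit => [a|_ [i _ <-]//]; exact: num_exc_norm b'E.
Qed.

Lemma coxeter_product_recl n (b : 'I_n.+1 -> K) :
  coxeter_product I b =
  reflection I (b ord0) \o coxeter_product I (fun i => b (lift ord0 i)).
Proof. exact: big_ord_recl. Qed.

Lemma coxeter_chi_orth n (b : 'I_n -> K) x z : (forall j, chi (b j) z = 0) ->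
  chi (coxeter_product I b x) z = chi x z.
Proof.
elim: n b => [|n IHn] b b0; first by rewrite /coxeter_product big_ord0.
rewrite coxeter_product_recl /= /reflection !chiE b0 mul0r subr0.
exact: IHn.
Qed.

(** Induction on the leftmost factor, applied last. By triangularity it leaves chi(b_j, -) unchanged
    for j > 0; for j = 0 it turns chi(b_0, c) into - chi(c, b_0), where [coxeter_chi_orth] allows c
    to be replaced by x. *)
Lemma coxeter_chi_basis n (b : 'I_n -> K) x : num_exc b ->
  forall j, chi (b j) (coxeter_product I b x) = - chi x (b j).
Proof.
elim: n b => [|n IHn] b [b1 b0] j; first by case: j.
rewrite coxeter_product_recl /=; set c := coxeter_product _ _ x.
have cE i : chi (b (lift ord0 i)) c = - chi x (b (lift ord0 i)).
  apply: (IHn (fun i => b (lift ord0 i))); split=> [l|l m lm]; first exact: b1.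
  exact: b0.
have c0 : chi c (b ord0) = chi x (b ord0).
  by apply: coxeter_chi_orth => i; apply: b0.
rewrite /reflection !chiE; case: (unliftP ord0 j) => [i ->|->].
  by rewrite cE [chi _ (b ord0)]b0 // mul0r subr0.
by rewrite b1 c0; lia.
Qed.

Lemma coxeter_chi n (b : 'I_n -> K) x y : num_exc b -> zbasis b ->
  chi y (coxeter_product I b x) = - chi x y.
Proof.
move=> bE bB; have [a [-> _]] := bB y.
rewrite chi_suml chi_sumr -sumrN; apply: eq_bigr => i _.
by rewrite coxeter_chi_basis // mulNr.
Qed.

Lemma coxeter_weyl n (b : 'I_n -> K) B : range b `<=` B ->
  weyl I B (coxeter_product I b).
Proof.
elim: n b => [|n IHn] b bB.
  by rewrite /coxeter_product big_ord0; apply: GenId.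
rewrite coxeter_product_recl; apply: GenComp.
  by apply: GenIn; exists (b ord0) => //; apply: bB; exists ord0.
by apply: IHn => _ [i _ <-]; apply: bB; exists (lift ord0 i).
Qed.

Lemma num_exc_root_system n (b : 'I_n -> K) : num_exc b -> zbasis b ->
  gen_root_system n I (weyl_orbit I (range b)) (coxeter_product I b).
Proof.
move=> bE bB; have norm a := @num_exc_norm n b a bE.
have bas : root_basis I (weyl_orbit I (range b)) b.
  by split=> //; [exact: orbit_sub|exact: weyl_orbitE].
split.
- by exists b.
- by split=> x y z; rewrite !chiE addrACA.
- by move=> x y; rewrite addrC.
- apply/seteqP; split=> // x _ P P0 PB PD.
  have PN y : P y -> P (- y) by move=> Py; rewrite -sub0r; apply: PB.
  have PA y z : P y -> P z -> P (y + z).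
    by move=> Py Pz; rewrite -[z]opprK; apply: PB => //; apply: PN.
  have Pn y m : P y -> P (y *+ m).
    by move=> Py; elim: m => // m IHm; rewrite mulrS; apply: PA.
  have [a [-> _]] := bB x; elim/big_ind: _ => // i _.
  have Pi : P (b i) by apply/PD/orbit_sub; exists i.
  by case: (a i) => m; [exact: Pn|rewrite NegzE mulrNz; apply/PN/Pn].
- by move=> a; apply: orbit_norm.
- by move=> a Da; apply: reflection_aut; apply: orbit_norm Da.
- move=> a Da; have Wa := orbit_reflection norm Da; apply/seteqP; split=> x.
    by move=> [y Dy <-]; apply: weyl_orbit_stable.
  move=> Dx; exists (reflection I a x); first exact: weyl_orbit_stable.
  exact: (reflectionK (orbit_norm norm Da)).
- by exists b.
- by apply: coxeter_weyl; apply: orbit_sub.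
- by exists b.
Qed.

Lemma reflection_self a : I a a = 2 -> reflection I a a = - a.
Proof. by rewrite /reflection => ->; rewrite -[a *~ 2]/(a + a) opprD addrA subrr sub0r. Qed.

Lemma reflectionN a x : reflection I a (- x) = - reflection I a x.
Proof. by rewrite /reflection !chiE -[X in a *~ X]opprD mulrNz opprB opprK addrC. Qed.

(** * Mutations of unitriangular bases *)

Section Mutation.
Variables (n : nat) (b b' : 'I_n -> K) (i i1 : 'I_n).
Hypothesis ii1 : i1 = i.+1 :> nat.
Hypothesis b'_other : forall j, j != i -> j != i1 -> b' j = b j.

(* x is the position of the mutated object in b' and y its position in b, so that
   left and right mutations are both covered. *)
Lemma mutation_orbit x y :
  num_exc b -> num_exc b' -> b x = b' y -> [set x; y] = [set i; i1] ->
  b' x = - reflection I (b x) (b y) ->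
  weyl_orbit I (range b') = weyl_orbit I (range b).
Proof.
move=> bE b'E bx xy b'x.
have xyP j : j != x -> j != y -> b' j = b j.
  move=> jx jy; have jxy : ~ [set x; y] j by case=> /eqP; apply/negP.
  by apply: b'_other; apply/eqP => ji; apply: jxy; rewrite xy; [left|right].
have norm j : I (b j) (b j) = 2 by rewrite bE.1.
have norm' j : I (b' j) (b' j) = 2 by rewrite b'E.1.
apply: orbit_eq => // j.
  have [->|jy] := eqVneq j y; first by rewrite -bx; apply: orbit_sub; exists x.
  have [->|jx] := eqVneq j x; last by rewrite xyP //; apply: orbit_sub; exists j.
  (* Since - b y is the reflection of b y in itself, b' x is obtained from b y by two reflections:
     the Weyl group absorbs the sign. *)
  rewrite b'x -reflectionN -(reflection_self (norm y)).
  apply: weyl_orbit_stable; first by apply: GenIn; exists (b x) => //; exists x.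
  apply: weyl_orbit_stable; first by apply: GenIn; exists (b y) => //; exists y.
  by apply: orbit_sub; exists y.
have [->|jx] := eqVneq j x; first by rewrite bx; apply: orbit_sub; exists y.
have [->|jy] := eqVneq j y; last by rewrite -xyP //; apply: orbit_sub; exists j.
have -> : b y = reflection I (b' y) (reflection I (b' x) (b' x)).
  rewrite reflection_self // b'x opprK -bx reflectionK //.
apply: weyl_orbit_stable; first by apply: GenIn; exists (b' y) => //; exists y.
apply: weyl_orbit_stable; first by apply: GenIn; exists (b' x) => //; exists x.
by apply: orbit_sub; exists x.
Qed.

Section NumericMutation.
Hypothesis b_exc : num_exc b.

Let i_lt_i1 : (i < i1)%N. Proof. by rewrite ii1. Qed.

Let b_i1i : chi (b i1) (b i) = 0. Proof. exact: b_exc.2. Qed.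

Let pos (j : 'I_n) : [\/ (j < i)%N, j = i, j = i1 | (i1 < j)%N].
Proof.
have [ji|ij|/val_inj ->] := ltngtP j i; [by constructor 1| |by constructor 2].
have [ji1|i1j|/val_inj ->] := ltngtP j i1; [|by constructor 4|by constructor 3].
by move: ji1; rewrite ii1 ltnS leqNgt ij.
Qed.

Let b'_lt (j : 'I_n) : (j < i)%N -> b' j = b j.
Proof.
move=> ji; apply: b'_other; rewrite -val_eqE neq_ltn ?ji //.
by rewrite (ltn_trans ji i_lt_i1).
Qed.

Let b'_gt (j : 'I_n) : (i1 < j)%N -> b' j = b j.
Proof.
move=> ji; apply: b'_other; rewrite -val_eqE neq_ltn ?ji ?orbT //.
by rewrite (ltn_trans i_lt_i1 ji) orbT.
Qed.

Let b_j (j : 'I_n) : (j < i)%N -> (chi (b i) (b j) = 0) * (chi (b i1) (b j) = 0).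
Proof. by move=> ji; split; apply: b_exc.2 => //; apply: ltn_trans i_lt_i1. Qed.

Let l_b (l : 'I_n) : (i1 < l)%N -> (chi (b l) (b i) = 0) * (chi (b l) (b i1) = 0).
Proof. by move=> il; split; apply: b_exc.2 => //; apply: ltn_trans il. Qed.

Lemma num_exc_right : b' i = b i1 -> b' i1 = - reflection I (b i1) (b i) ->
  num_exc b' /\ weyl_orbit I (range b') = weyl_orbit I (range b).
Proof.
move=> b'i b'i1; have [b1 b0] := b_exc.
have b'E : num_exc b'.
  (* As chi(b_(i+1), b_i) = 0, the coefficient of the reflection is the single term chi(b_i,
     b_(i+1)). *)
  rewrite /reflection b_i1i addr0 in b'i1.
  split=> [l|l j jl].
    case: (pos l) => [li|->|->|li].
    - by rewrite b'_lt.
    - by rewrite b'i.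
    - by rewrite b'i1 !chiE b_i1i !b1; ring.
    - by rewrite b'_gt.
  case: (pos l) (pos j) jl => [li|->|->|li] [ji|->|->|ji] jl;
    rewrite ?(b'_lt li) ?(b'_gt li) ?(b'_lt ji) ?(b'_gt ji) ?b'i ?b'i1 ?chiE ?b1;
    rewrite ?(b_j ji) ?(l_b li) ?(b0 _ _ jl) ?b_i1i; try lia; try ring.
split=> //; apply: (@mutation_orbit i1 i) => //.
by apply/seteqP; split=> x [->|->]; by [left|right].
Qed.

Lemma num_exc_left : b' i = - reflection I (b i) (b i1) -> b' i1 = b i ->
  num_exc b' /\ weyl_orbit I (range b') = weyl_orbit I (range b).
Proof.
move=> b'i b'i1; have [b1 b0] := b_exc.
have b'E : num_exc b'.
  rewrite /reflection b_i1i add0r in b'i.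
  split=> [l|l j jl].
    case: (pos l) => [li|->|->|li].
    - by rewrite b'_lt.
    - by rewrite b'i !chiE b_i1i !b1; ring.
    - by rewrite b'i1.
    - by rewrite b'_gt.
  case: (pos l) (pos j) jl => [li|->|->|li] [ji|->|->|ji] jl;
    rewrite ?(b'_lt li) ?(b'_gt li) ?(b'_lt ji) ?(b'_gt ji) ?b'i ?b'i1 ?chiE ?b1;
    rewrite ?(b_j ji) ?(l_b li) ?(b0 _ _ jl) ?b_i1i; try lia; try ring.
by split=> //; apply: (@mutation_orbit i i1).
Qed.

End NumericMutation.

End Mutation.

(** This covers translations, which change the sign of a class; - b_j is the reflection of b_j in
    itself. *)
Lemma num_exc_sign n (b b' : 'I_n -> K) : num_exc b ->
  (forall j, b' j = b j \/ b' j = - b j) ->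
  num_exc b' /\ weyl_orbit I (range b') = weyl_orbit I (range b).
Proof.
move=> bE bb'; have [b1 b0] := bE; have b'E : num_exc b'.
  split=> [i|i j ji].
    by case: (bb' i) => ->; rewrite ?chiE ?opprK.
  by case: (bb' i) (bb' j) => [->|->] [->|->]; rewrite ?chiE b0 ?oppr0.
have norm j : I (b j) (b j) = 2 by rewrite b1.
have norm' j : I (b' j) (b' j) = 2 by rewrite b'E.1.
split=> //; apply: orbit_eq => // j.
  case: (bb' j) => ->; first by apply: orbit_sub; exists j.
  rewrite -(reflection_self (norm j)); apply: weyl_orbit_stable.
    by apply: GenIn; exists (b j) => //; exists j.
  by apply: orbit_sub; exists j.
case: (bb' j) => b'j; first by rewrite -b'j; apply: orbit_sub; exists j.
rewrite -[b j]opprK -b'j -(reflection_self (norm' j)); apply: weyl_orbit_stable.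
  by apply: GenIn; exists (b' j) => //; exists j.
by apply: orbit_sub; exists j.
Qed.

End ExceptionalBasis.

(** * Classes of mutations *)

(** Natural-number indices let basis vectors of Hom spaces in all degrees be labelled by pairs (p,
    i) of a single type; out of range the chosen vectors and forms are 0. *)
Lemma coords_nat (k : fieldType) (V : lmodType k) : fd V ->
  exists (e : nat -> V) (c : nat -> {linear V -> k^o}),
  (forall v, v = \sum_(i < dimk V) c i v *: e i) /\
  forall i j, (i < dimk V)%N -> (j < dimk V)%N -> c i (e j) = (i == j)%:R.
Proof.
move=> /coords [n [e [c [Vn vE ceE]]]]; rewrite (dimkE Vn).
exists (fun i => if insub i is Some j then e j else 0).
exists (fun i => if insub i is Some j then c j else (\0 : {linear V -> k^o})).
split=> [v|i j lt_i lt_j]; last by rewrite !insubT ceE.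
by rewrite {1}[v]vE; apply: eq_bigr => i _; rewrite valK.
Qed.

Section Biproducts.
Variables (k : fieldType) (I : eqType).

Definition family_biproduct (C : lcat k) (A : I -> C) (s : seq I) (B : C)
    (inj : forall i, hom (A i) B) (prj : forall i, hom B (A i)) :=
  [/\ forall i, i \in s -> prj i \oc inj i = idm (A i),
      forall i j, i != j -> prj i \oc inj j = 0
    & \sum_(i <- s) inj i \oc prj i = idm B].

Definition delta_hom (C : lcat k) (A : I -> C) i j : hom (A i) (A j) :=
  if i =P j is ReflectT e then ecast x (hom (A i) (A x)) e (idm (A i)) else 0.

Lemma delta_homii (C : lcat k) (A : I -> C) i : delta_hom A i i = idm (A i).
Proof. by rewrite /delta_hom; case: eqP => // e; rewrite eq_axiomK. Qed.

Lemma delta_hom_neq (C : lcat k) (A : I -> C) i j : i != j -> delta_hom A i j = 0.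
Proof. by rewrite /delta_hom; case: eqP. Qed.

(** The structure maps are kept zero outside [s], so a new summand A a can be inserted uniformly in
    the index through the Kronecker symbol [delta_hom], without interfering with the old maps. *)
Lemma family_biproduct_ex (D : tricat k) (A : I -> D) (s : seq I) : uniq s ->
  exists B (inj : forall i, hom (A i) B) (prj : forall i, hom B (A i)),
  [/\ family_biproduct s inj prj,
      forall i, i \notin s -> inj i = 0 /\ prj i = 0
    & K0_class B = \sum_(i <- s) K0_class (A i)].
Proof.
elim: s => [_|a s IHs /= /andP[as_ us]].
  have [Z Z0] := (tcat_additive D).1; exists Z, (fun=> 0), (fun=> 0).
  split=> //; last by rewrite big_nil K0_zero.
  by split=> // [i j _|]; rewrite ?comp0r // big_nil; apply/esym/zero_objP.
have [B [inj [prj [[pii pij sumE] out clB]]]] := IHs us.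
have [T [i0 [j0 [p0 [q0 [pi qj qi pj ij]]]]]] := (tcat_additive D).2 (A a) B.
have [inja prja] := out a as_.
exists T, (fun i => i0 \oc delta_hom A i a + j0 \oc inj i).
exists (fun i => delta_hom A a i \oc p0 + prj i \oc q0).
have prj_inj i j : (delta_hom A a i \oc p0 + prj i \oc q0) \oc
    (i0 \oc delta_hom A j a + j0 \oc inj j)
    = delta_hom A a i \oc delta_hom A j a + prj i \oc inj j.
  rewrite compDl !compDr -!compA (compA p0 i0) pi (compA p0 j0) pj.
  by rewrite (compA q0 i0) qi (compA q0 j0) qj !comp1m !comp0l !comp0r addr0 add0r.
split; first split.
- move=> i; rewrite inE prj_inj => /predU1P[->|is_].
    by rewrite delta_homii comp1m inja comp0r addr0.
  have ia : a != i by apply: contraNneq as_ => ->.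
  by rewrite delta_hom_neq // comp0l add0r pii.
- move=> i j ij'; rewrite prj_inj pij // addr0.
  have [ai|ai] := eqVneq a i; last by rewrite delta_hom_neq // comp0l.
  by rewrite [delta_hom A j a]delta_hom_neq ?comp0r // ai eq_sym.
- rewrite big_cons inja prja !delta_homii comp0r comp0l !addr0 compm1 comp1m.
  rewrite -ij; congr (_ + _).
  rewrite -[q0 in RHS]comp1m -sumE comp_suml comp_sumr.
  apply: eq_big_seq => i is_; have ia : a != i by apply: contraNneq as_ => ->.
  have ia' : i != a by rewrite eq_sym.
  by rewrite (delta_hom_neq A ia) (delta_hom_neq A ia') comp0r comp0l !add0r !compA.
- move=> i; rewrite inE negb_or => /andP[ia /out [-> ->]].
  have ia' : a != i by rewrite eq_sym.
  by rewrite (delta_hom_neq A ia) (delta_hom_neq A ia') !comp0r !comp0l !addr0.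
by rewrite big_cons -clB; apply: dist_biproduct pi qj qi pj ij.
Qed.

End Biproducts.

Section Cotensor.
Variables (k : fieldType) (C : lcat k) (A : int -> C) (V : int -> lmodType k).
Hypothesis V_fd : forall p, fd (V p).

(** This is [rhom_cotensor] with the category and the graded space abstracted; read in [op_cat] it
    becomes [rhom_tensor]. *)
Definition cotensor (T : C) (w : forall p, {linear V p -> hom T (A p)}) :=
  forall Z (phi : forall p, {linear V p -> hom Z (A p)}),
    exists! g : hom Z T, forall p v, w p v \oc g = phi p v.

Lemma cotensor_isom T w T' w' :
  @cotensor T w -> @cotensor T' w' -> isom T T'.
Proof.
move=> wP w'P; have [a [aE _]] := w'P T w; have [b [bE _]] := wP T' w'.
exists a, b; split.
  have [c [_ cU]] := wP T w; rewrite -(cU (b \oc a)) ?(cU (idm T)) // => p v.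
    by rewrite compm1.
  by rewrite compA bE aE.
have [c [_ cU]] := w'P T' w'; rewrite -(cU (a \oc b)) ?(cU (idm T')) // => p v.
  by rewrite compm1.
by rewrite compA aE bE.
Qed.

Variables (s : seq (int * nat)) (B : C).
Variables (inj : forall x : int * nat, hom (A x.1) B).
Variables (prj : forall x : int * nat, hom B (A x.1)).
Hypothesis s_uniq : uniq s.
Hypothesis sE : forall p i, ((p, i) \in s) = (i < dimk (V p))%N.
Hypothesis B_biprod : family_biproduct s inj prj.

(** Degree p contributes dim V_p copies of A p. The map [w] sends v to the combination of the
    projections with the coordinates of v, so a map into B is determined by the values required on
    basis vectors. *)
Lemma biproduct_cotensor :
  exists w : forall p, {linear V p -> hom B (A p)}, cotensor w.
Proof.
have [pii pij sumE] := B_biprod.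
pose ec p := cid (coords_nat (V_fd p)).
pose e p := sval (ec p); pose c p := sval (cid (svalP (ec p))).
have vE p v : v = \sum_(i < dimk (V p)) c p i v *: e p i.
  exact: (svalP (cid (svalP (ec p)))).1.
have ceE p i j : (i < dimk (V p))%N -> (j < dimk (V p))%N ->
    c p i (e p j) = (i == j)%:R.
  exact: (svalP (cid (svalP (ec p)))).2.
pose pr p i : hom B (A p) := prj (p, i).
pose w0 p v := \sum_(i < dimk (V p)) c p i v *: pr p i.
have w0L p : linear (w0 p).
  move=> a u v; rewrite /w0 scaler_sumr -big_split /=; apply: eq_bigr => i _.
  by rewrite lformP scalerDl scalerA.
have w0e p i : (i < dimk (V p))%N -> w0 p (e p i) = pr p i.
  move=> ip; rewrite /w0 (bigD1 (Ordinal ip)) //= ceE // eqxx scale1r.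
  rewrite big1 ?addr0 // => j ji; rewrite ceE // -[i]/(val (Ordinal ip)).
  by rewrite val_eqE (negPf ji) scale0r.
exists (fun p => lin (w0L p)) => Z phi.
exists (\sum_(x <- s) inj x \oc phi x.1 (e x.1 x.2)); split=> [p v|g gE].
  rewrite /= /w0 comp_suml {2}[v]vE linear_sum; apply: eq_bigr => i _.
  rewrite compZl linearZ_LR; congr (_ *: _); rewrite /pr comp_sumr.
  have ips : (p, i : nat) \in s by rewrite sE.
  rewrite (bigD1_seq (p, i : nat)) //= compA (pii (p, i : nat)) // comp1m big1 ?addr0 // => x xs.
  by rewrite compA (pij (p, i : nat)) ?comp0l // eq_sym.
rewrite -[g]comp1m -sumE comp_suml; apply: eq_big_seq => -[p i] /=.
by rewrite sE => ip; rewrite -gE /= w0e // compA.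
Qed.

End Cotensor.

Section MutationClasses.
Variables (k : fieldType) (D : tricat k).
Hypothesis D_fin : finite_type D.
Implicit Types X Y Z T : D.
Local Notation cl := (@K0_class k D).

Lemma euler_seq X Y (s : seq int) : uniq s ->
  (forall q, q \notin s -> forall f : hom X (shiftn Y q), f = 0) ->
  euler X Y = \sum_(q <- s) (-1) ^ q * (dimk (hom X (shiftn Y q)))%:Z.
Proof.
move=> us s0; rewrite /euler (fsbigE s) // => [|q _ qs].
  by apply: eq_bigl => q; rewrite in_setT.
by rewrite dimk0 ?mulr0 //; apply: s0.
Qed.

Lemma power_biproduct (A : int -> D) (X : D) (d : int -> nat) (s : seq int) :
  uniq s -> (forall p, p \notin s -> d p = 0%N) ->
  (forall p, cl (A p) = cl X *~ ((-1) ^ p)) ->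
  exists (r : seq (int * nat)) B (inj : forall x : int * nat, hom (A x.1) B)
    (prj : forall x : int * nat, hom B (A x.1)),
  [/\ uniq r, forall p i, ((p, i) \in r) = (i < d p)%N, family_biproduct r inj prj
    & cl B = cl X *~ (\sum_(p <- s) (-1) ^ p * (d p)%:Z)].
Proof.
move=> us ds AE; pose r := [seq (p, i) | p <- s, i <- iota 0 (d p)].
have ur : uniq r.
  apply: allpairs_uniq_dep => // [p _|]; first exact: iota_uniq.
  by move=> [p i] [q j] _ _ /= [-> ->].
have [B [inj [prj [bip _ clB]]]] := family_biproduct_ex (fun x => A x.1) ur.
exists r, B, inj, prj; split=> // [p i|].
  apply/allpairsPdep/idP => [[q [j [_ + [-> ->]]]]|ip]; first by rewrite mem_iota.
  exists p, i; split; [|by rewrite mem_iota|by []].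
  by apply: contraLR ip => /ds ->.
rewrite clB big_allpairs_dep mulrz_sumr; apply: eq_bigr => p _ /=.
rewrite AE big_const_seq count_predT size_iota iter_addr_0.
by rewrite mulrzA.
Qed.

Lemma cotensor_class X Y T (w : forall p, {linear hom X (shiftn Y p) -> hom T (shiftn Y p)}) :
  rhom_cotensor w -> cl T = cl Y *~ euler X Y.
Proof.
move=> wP; have [s0 sP] := fin_support D_fin X Y; pose s := undup s0.
have us : uniq s by apply: undup_uniq.
have s_out q : q \notin s -> forall f : hom X (shiftn Y q), f = 0.
  by rewrite mem_undup; apply: sP.
have [||r [B [inj [prj [ur rE bip clB]]]]] := @power_biproduct (shiftn Y) Y
    (fun p => dimk (hom X (shiftn Y p))) s us.
- by move=> p ps; apply/dimk0/s_out.
- exact: K0_shiftn.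
have [w' w'P] := @biproduct_cotensor k D (shiftn Y) (fun p => hom X (shiftn Y p))
  (fun p => hom_fd D_fin _ _) r B inj prj ur rE bip.
rewrite (K0_isom (@cotensor_isom k D (shiftn Y) _ T w B w' wP w'P)) clB.
by rewrite (euler_seq us s_out).
Qed.

(** The cotensor computation is repeated in the opposite category. Degrees change sign, as Hom(X[p],
    Y) is Hom(X, Y[-p]), but parities do not. *)
Lemma tensor_class X Y T (u : forall p, {linear hom (shiftn X p) Y -> hom (shiftn X p) T}) :
  rhom_tensor u -> cl T = cl X *~ euler X Y.
Proof.
move=> uP; have [s0 sP] := fin_support D_fin X Y; pose s := undup s0.
have us : uniq s by apply: undup_uniq.
have s_out q : q \notin s -> forall f : hom X (shiftn Y q), f = 0.
  by rewrite mem_undup; apply: sP.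
pose t := map -%R s; have ut : uniq t by rewrite map_inj_uniq //; apply: oppr_inj.
have dE p : dimk (hom (shiftn X p) Y) = dimk (hom X (shiftn Y (- p))).
  exact: lbij_dimk (lbij_shiftn_l _ _ _).
have [||r [B [inj [prj [ur rE [bip1 bip2 bip3] clB]]]]] := @power_biproduct (shiftn X) X
    (fun p => dimk (hom (shiftn X p) Y)) t ut.
- move=> p pt; rewrite dE; apply/dimk0/s_out; apply: contra pt => ps.
  by rewrite -[p]opprK map_f.
- exact: K0_shiftn.
have [|w' w'P] := @biproduct_cotensor k (op_cat D) (shiftn X)
  (fun p => hom (shiftn X p) Y) (fun p => hom_fd D_fin _ _) r B prj inj ur rE.
  by split=> // x y xy; apply: bip2; rewrite eq_sym.
have TB : isom T B.
  have [a [b [ab ba]]] := @cotensor_isom k (op_cat D) (shiftn X) _ T u B w' uP w'P.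
  by exists b, a.
rewrite (K0_isom TB) clB (euler_seq us s_out) /t big_map; congr (_ *~ _).
apply: eq_bigr => q _; rewrite dE opprK; congr (_ * _).
by rewrite -exprz_inv invrN1.
Qed.

Lemma right_mutation_class X Y R : right_mutation X Y R ->
  cl R = - cl X + cl Y *~ euler X Y.
Proof.
move=> [T [w [coev [g [h [wP _ tri]]]]]].
by rewrite -(cotensor_class wP) (K0_dist tri) addKr.
Qed.

Lemma left_mutation_class X Y L : left_mutation X Y L ->
  cl L = - cl Y + cl X *~ euler X Y.
Proof.
move=> [T [u [ev [g [h [uP _ tri]]]]]].
by rewrite -(tensor_class uP) (K0_dist tri) K0_shift opprD opprK addrAC addNr add0r.
Qed.

End MutationClasses.

(** * The root system of a category with a full exceptional collection *)

Section RootSystem.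
Variables (k : fieldType) (D : tricat k).
Hypothesis D_fin : finite_type D.
Variable chi : K0 D -> K0 D -> int.
Hypothesis chiP : euler_form chi.
Implicit Types X Y Z T : D.
Local Notation cl := (@K0_class k D).
Local Notation classes E := (fun i => K0_class (E i)).

Lemma exceptional_dim X : exceptional X -> has_dim (hom X X) 1.
Proof.
move=> [_ X0 sc]; have fL : linear (fun x : 'rV[k]_1 => x 0 0 *: idm X).
  by move=> a u v; rewrite !mxE scalerDl scalerA.
exists (lin fL); apply: inj_surj_bij => [x y /= /eqP|f].
  rewrite -subr_eq0 -scalerBl scaler_eq0 (negPf X0) orbF subr_eq0 => /eqP xy.
  by apply/rowP => i; rewrite !ord1.
by have [a ->] := sc f; exists a%:M; rewrite /= mxE eqxx mulr1n.
Qed.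

Lemma exc_num_exc n (E : 'I_n -> D) : exc_collection E ->
  num_exc chi (classes E).
Proof.
move=> [E1 E0]; split=> [i|i j ji]; rewrite chiP.2.
  have [Ei0 _ _] := E1 i; rewrite (@euler_seq k D _ _ [:: 0]) // => [|q].
    rewrite big_seq1 expr0z mul1r (dimkE (exceptional_dim (E1 i))) //.
  by rewrite inE; apply: Ei0.
by rewrite (@euler_seq k D _ _ [::]) // ?big_nil // => q _; apply: E0.
Qed.

Lemma full_exc_gen n (E : 'I_n -> D) (P : K0 D -> Prop) : full_collection E ->
  P 0 -> (forall x y, P x -> P y -> P (x - y)) -> (forall i, P (cl (E i))) ->
  forall x, P x.
Proof.
move=> Efull P0 PB PE; have PN x : P x -> P (- x).
  by move=> Px; rewrite -sub0r; apply: PB.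
apply: K0_ind => //; apply: (@full_ind k D n E (fun X => P (cl X)) Efull) => //.
split=> [X Y /K0_isom ->//|Z /K0_zero ->//|X|X|X Y Z f g h /K0_dist YE PX PY].
- by rewrite K0_shift; apply: PN.
- by rewrite K0_unshift; apply: PN.
- by rewrite -[cl Z](addKr (cl X)) -YE addrC; apply: PB.
Qed.

Lemma full_exc_zbasis n (E : 'I_n -> D) : full_exc E -> zbasis (classes E).
Proof.
move=> [Eexc Efull]; apply: (num_exc_zbasis chiP.1 (exc_num_exc Eexc)) => P.
exact: full_exc_gen.
Qed.

(** Injectivity of [phi] gives nondegeneracy on one side; surjectivity, as forms separate vectors,
    gives the other. Each yields one inequality of dimensions. *)
Lemma serre_dim (S : lfunctor D D) X Y : serre_functor S ->
  dimk (hom X Y) = dimk (hom Y (S X)).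
Proof.
move=> [_ [phi [phiL phiB _]]]; have XY := hom_fd D_fin X Y.
have YX := hom_fd D_fin Y (S X).
have [psi phiK psiK] := phiB X Y.
have phi0 g : phi X Y 0 g = 0.
  by have := phiL X Y (-1) 0 0 g; rewrite scaleN1r addNr mulN1r addNr.
have nd_tgt g : (forall f, phi X Y f g = 0) -> g = 0.
  by move=> g0; apply: sep_form => // f; rewrite -[f]psiK g0.
have phiTL g : linear (fun f => phi X Y f g : k^o) by move=> a f f'; apply: phiL.
have nd_src f : (forall g, phi X Y f g = 0) -> f = 0.
  move=> f0; apply: (can_inj phiK); apply: lin_inj => g.
  by rewrite f0 phi0.
apply/eqP; rewrite eqn_leq; apply/andP; split.
  apply: (@pairing_dim_le k (hom Y (S X)) (hom X Y) (fun g => lin (phiTL g))) => //.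
  - by move=> a g g' f; rewrite /= lformP.
  - exact: dimkP.
  - exact: dimkP.
apply: (@pairing_dim_le k (hom X Y) (hom Y (S X)) (phi X Y)) => //; exact: dimkP.
Qed.

(** The degree is moved from SX to Y: Hom(Y, SX[q]) is Hom(Y[-q], SX), dual to Hom(X, Y[-q]), and q
    and -q have the same parity. *)
Lemma euler_serre (S : lfunctor D D) X Y : serre_functor S ->
  euler Y (S X) = euler X Y.
Proof.
move=> SP; have [s0 sP] := fin_support D_fin X Y; pose s := undup s0.
have us : uniq s by apply: undup_uniq.
have s_out q : q \notin s -> forall f : hom X (shiftn Y q), f = 0.
  by rewrite mem_undup; apply: sP.
have dE q : dimk (hom Y (shiftn (S X) q)) = dimk (hom X (shiftn Y (- q))).
  rewrite (serre_dim X (shiftn Y (- q)) SP); apply/esym/lbij_dimk.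
  by have := lbij_shiftn_l Y (S X) (- q); rewrite opprK.
rewrite (euler_seq us s_out) (@euler_seq k D Y (S X) (map -%R s)).
- rewrite big_map; apply: eq_bigr => q _; rewrite dE opprK.
  by rewrite -exprz_inv invrN1.
- by rewrite map_inj_uniq //; apply: oppr_inj.
move=> q qs; have d0 : dimk (hom Y (shiftn (S X) q)) = 0%N.
  rewrite dE; apply/dimk0/s_out; apply: contra qs => qs.
  by rewrite -[q]opprK map_f.
have := dimkP (hom_fd D_fin Y (shiftn (S X) q)); rewrite d0.
by move=> [f [g _ gK]] x; rewrite -[x]gK [g x]thinmx0 linear0.
Qed.

Lemma coxeter_induced n (E : 'I_n -> D) (S : lfunctor D D) :
  full_exc E -> serre_functor S ->
  induced_on_K0 (coxeter_functor S) (coxeter_product (cartan_form chi) (classes E)).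
Proof.
move=> EP SP; have [Eexc _] := EP; have bE := exc_num_exc Eexc.
have bB := full_exc_zbasis EP.
have Wc := @coxeter_weyl _ chi _ (classes E) _ (fun x => id).
have norm a := @num_exc_norm _ chi _ (classes E) a bE.
have [cB cD _] := weyl_aut chiP.1 norm Wc.
split=> // X; apply/eqP; rewrite -subr_eq0; apply/eqP.
apply: (chi_nondeg chiP.1 bE bB) => j; rewrite K0_unshift opprK (chiDr chiP.1).
by rewrite (coxeter_chi chiP.1 _ _ bE bB) !chiP.2 (euler_serre _ _ SP) addNr.
Qed.

(** Exceptionality enters and leaves in numerical form, so that the lemma can be iterated along a
    word. *)
Lemma letter_orbit n (x : gmu_letter n) (E E' : 'I_n -> D) : letter_acts x E E' ->
  num_exc chi (classes E) ->
  num_exc chi (classes E') /\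
  weyl_orbit (cartan_form chi) (range (classes E'))
    = weyl_orbit (cartan_form chi) (range (classes E)).
Proof.
case: x => s [i|i] /= xE bE; last first.
  apply: (num_exc_sign chiP.1) => // j.
  case: s xE => /(_ j) /K0_isom <-; case: ifP => _; rewrite ?K0_unshift ?K0_shift;
    by [left|right].
(* A braid generator exists only if n is at least 2, so position i + 1 is in range. *)
have i1_lt : (i.+1 < n)%N by have := ltn_ord i; lia.
pose i1 := Ordinal i1_lt; pose i0 := Ordinal (ltnW i1_lt).
have b_i1i : chi (cl (E i1)) (cl (E i0)) = 0 by apply: bE.2.
have other j : j != i0 -> j != i1 -> cl (E' j) = cl (E j).
  rewrite -!val_eqE /= => /eqP ji /eqP ji1.
  by case: s xE => /(_ j) [_ _ /(_ ji ji1) /K0_isom].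
case: s xE => xE.
  have [/(_ erefl i1 erefl) E'0 _ _] := xE i0.
  have [_ /(_ erefl i0 erefl) E'1 _] := xE i1.
  apply: (@num_exc_left _ chi chiP.1 _ (classes E) _ i0 i1) => //.
    rewrite /reflection b_i1i add0r chiP.2 opprB addrC.
    exact: left_mutation_class E'0.
  exact/esym/K0_isom.
have [/(_ erefl i1 erefl) E'0 _ _] := xE i0.
have [_ /(_ erefl i0 erefl) E'1 _] := xE i1.
apply: (@num_exc_right _ chi chiP.1 _ (classes E) _ i0 i1) => //.
  exact/esym/K0_isom.
rewrite /reflection b_i1i addr0 chiP.2 opprB addrC.
exact: right_mutation_class E'1.
Qed.

Lemma word_orbit n (w : gmu_word n) (E E' : 'I_n -> D) : word_acts w E E' ->
  num_exc chi (classes E) ->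
  num_exc chi (classes E') /\
  weyl_orbit (cartan_form chi) (range (classes E'))
    = weyl_orbit (cartan_form chi) (range (classes E)).
Proof.
elim: w E' => [|x w IHw] E' /= => [EE' bE|[E1 /IHw wE1 /letter_orbit xE'] bE].
  have -> : classes E' = classes E by apply/funext => i; apply/esym/K0_isom.
  by [].
by have [/xE' [b'E ->] <-] := wE1 bE.
Qed.

End RootSystem.

Theorem proposition2p9 (k : closedFieldType) (D : tricat k)
  (mu : nat) (E : 'I_mu -> D)
  (k_char0 : [pchar k] =i pred0)
  (D_algebraic : algebraic D)
  (D_finite_type : finite_type D)
  (E_strongly_exc : strongly_exc E)
  (E_full : full_collection E)
  (G_transitive : gmu_transitive D mu)
  (exc_completes : forall X : D, exceptional X ->
     exists (n : nat) (E' : 'I_n -> D) (i : 'I_n), full_exc E' /\ E' i = X) :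
  (exists S : lfunctor D D, serre_functor S) /\
  exists chi : K0 D -> K0 D -> int,
    euler_form chi /\
    (forall S : lfunctor D D, serre_functor S ->
       exists c : K0 D -> K0 D,
         induced_on_K0 (coxeter_functor S) c /\
         gen_root_system mu (cartan_form chi) (real_roots (cartan_form chi) E) c) /\
    (forall (n : nat) (E' : 'I_n -> D), full_exc E' ->
       real_roots (cartan_form chi) E' = real_roots (cartan_form chi) E).
Proof.
have EP : full_exc E by split; [case: E_strongly_exc|].
split; first exact: serre_functor_ex D_finite_type _ _ EP.
have [chi chiP] := euler_form_ex D_finite_type; exists chi; split=> //.
have bE := exc_num_exc chiP EP.1; have bB := full_exc_zbasis chiP EP.
split=> [S SP|n E' E'P].
  exists (coxeter_product (cartan_form chi) (fun i => K0_class (E i))); split.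
    exact: coxeter_induced.
  exact: num_exc_root_system chiP.1 _ _ bE bB.
(* Transitivity relates collections of length mu only, so the length of E' is first identified with
   the rank. *)
have nmu := zbasis_size (full_exc_zbasis chiP E'P) bB; subst n.
have [g [w _ wE]] := G_transitive E E' EP E'P.
exact: (word_orbit D_finite_type chiP wE bE).2.
Qed.
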